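(* For every $n=3$ or $n\ge5$, among the metrics $(x,x,z,u,1)$ ($x,z,u>0$, $u\neq 1$) on $\mathrm{SU}(n)^3/\Delta\mathrm{SO}(n)$ there is exactly one Einstein metric with $\frac16<u<1$ and exactly one Einstein metric with $u>1$. Equivalently, the asymmetric branch $\{(x,x,z,u,1):x,z,u>0,\ u\ne1\}$ contains exactly two Einstein metrics up to the chosen normalization (that the second anti-diagonal scale be $1$).
   Context: $H=\mathrm{SU}(n)$, $K=\mathrm{SO}(n)$, $\mathfrak h=\mathfrak k\oplus\mathfrak q$ the Cartan decomposition, $Q=-B_{\mathfrak h}$ (negative Killing form) on each factor of $\mathfrak h^3$, $\Delta K=\{(k,k,k)\}$. The tangent space of $H^3/\Delta K$ at the origin is identified with the $Q$-orthogonal complement of $\Delta\mathfrak k$, namely $\mathfrak q_1\oplus\mathfrak q_2\oplus\mathfrak q_3\oplus(v_1\otimes\mathfrak k)\oplus(v_2\otimes\mathfrak k)$, where $\mathfrak q_i$ is the copy of $\mathfrak q$ in the $i$-th factor, $v_1=\frac1{\sqrt2}(1,-1,0)$, $v_2=\frac1{\sqrt6}(1,1,-2)$ and $t\otimes\mathfrak k=\{(t_1X,t_2X,t_3X):X\in\mathfrak k\}$. The notation $(x,x,z,u,1)$ denotes the $H^3$-invariant metric $xQ|_{\mathfrak q_1}+xQ|_{\mathfrak q_2}+zQ|_{\mathfrak q_3}+uQ|_{v_1\otimes\mathfrak k}+Q|_{v_2\otimes\mathfrak k}$ with these summands mutually orthogonal. *)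

(* Defs.v *)
From HB Require Import structures.
From mathcomp Require Import all_boot all_order all_algebra.
From mathcomp Require Import reals complex.

Set Implicit Arguments.
Unset Strict Implicit.
Unset Printing Implicit Defensive.

Import Order.TTheory GRing.Theory Num.Theory.

Local Open Scope ring_scope.
Local Open Scope complex_scope.

(* Trace on the subspace U of an operator f that is linear on U and maps U to
   itself; it does not depend on the basis. *)
Definition vtrace (R : fieldType) (V : vectType R) (U : {vspace V})
    (f : V -> V) : R :=
  \sum_(i < \dim U) coord (vbasis U) i (f (vbasis U)`_i).

Definition killing (R : fieldType) (V : vectType R) (br : V -> V -> V)
    (h : {vspace V}) (X Y : V) : R :=
  vtrace h (fun Z => br X (br Y Z)).

(* Invariant metrics on a reductive homogeneous space G/K with Lie algebra
   k (+) p: the tangent space at the origin is p, an invariant metric is an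
   Ad(K)-invariant inner product g on p, and invariant connections on G/K are
   bilinear maps L : p x p -> p (Nomizu), "L X Y" being the value of Lambda(X)
   at Y. All the maps below matter only on p. *)
Section ReductiveHomogeneousSpace.
Variables (R : realType) (V : vectType R) (br : V -> V -> V).
Variables (k p : {vspace V}) (g : V -> V -> R).

(* The p- and k-components of an element of p (+) k. *)
Definition prp (X : V) : V := daddv_pi p k X.
Definition prk (X : V) : V := daddv_pi k p X.

(* The Levi-Civita connection, L X Y = [X, Y]_p / 2 + U(X, Y), given by the
   Koszul formula. It is unique on p since g is nondegenerate there. *)
Definition is_levi_civita (L : V -> V -> V) : Prop :=
  {in p &, forall X Y, L X Y \in p} /\
  {in p & &, forall X Y Z,
    2 * g (L X Y) Z =
      g (prp (br X Y)) Z + g (prp (br Z X)) Y + g X (prp (br Z Y))}.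

(* R(X, Y) = [L X, L Y] - L [X, Y]_p - ad [X, Y]_k *)
Definition curvature (L : V -> V -> V) (X Y Z : V) : V :=
  L X (L Y Z) - L Y (L X Z) - L (prp (br X Y)) Z - br (prk (br X Y)) Z.

Definition ricci (L : V -> V -> V) (Y Z : V) : R :=
  vtrace p (fun X => curvature L X Y Z).

Definition einstein : Prop :=
  exists L, is_levi_civita L /\
    exists lambda : R, {in p &, forall X Y, ricci L X Y = lambda * g X Y}.

End ReductiveHomogeneousSpace.

(* Complex n x n matrices as a real vector space. *)
Definition cmat (R : realType) (n : nat) : Type := 'M[R[i]]_n.

Section ComplexMatrices.
Variables (R : realType) (n : nat).
Local Notation cmat := (cmat R n).

HB.instance Definition _ := GRing.Zmodule.on cmat.

Definition cmat_scale (a : R) (X : cmat) : cmat :=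
  a%:C *: (X : 'M[R[i]]_n).

Fact cmat_scaleA a b X : cmat_scale a (cmat_scale b X) = cmat_scale (a * b) X.
Proof. by rewrite /cmat_scale scalerA rmorphM. Qed.
Fact cmat_scale1 : left_id 1 cmat_scale.
Proof. by move=> X; rewrite /cmat_scale scale1r. Qed.
Fact cmat_scaleDr : right_distributive cmat_scale +%R.
Proof. by move=> a X Y; rewrite /cmat_scale scalerDr. Qed.
Fact cmat_scaleDl X : {morph cmat_scale^~ X : a b / a + b}.
Proof. by move=> a b; rewrite /cmat_scale rmorphD scalerDl. Qed.

HB.instance Definition _ := GRing.Zmodule_isLmodule.Build R cmat
  cmat_scaleA cmat_scale1 cmat_scaleDr cmat_scaleDl.

Lemma cmat_scaleE (a : R) (X : cmat) i j : (a *: X) i j = a%:C * X i j.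
Proof. by rewrite mxE. Qed.

Fact cmat_vect_iso : Vector.axiom (n * n + n * n) cmat.
Proof.
exists (fun X : cmat => row_mx (mxvec (map_mx (@complex.Re R) X))
                               (mxvec (map_mx (@complex.Im R) X))).
  move=> a X Y; rewrite scale_row_mx add_row_mx -!linearZ -!linearD /=.
  congr (row_mx (mxvec _) (mxvec _)); apply/matrixP=> i j;
    rewrite !mxE; case: (X i j) (Y i j) => [b c] [d e] //=;
    by rewrite mul0r ?subr0 ?addr0.
exists (fun v => (\matrix_(i, j) (vec_mx (lsubmx v) i j
                              +i* vec_mx (rsubmx v) i j) : cmat)).
  move=> X; rewrite row_mxKl row_mxKr !mxvecK; apply/matrixP=> i j.
  by rewrite !mxE; case: (X i j).
move=> v; rewrite -[RHS]hsubmxK -[lsubmx v in RHS]vec_mxK.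
rewrite -[rsubmx v in RHS]vec_mxK.
by congr (row_mx (mxvec _) (mxvec _)); apply/matrixP=> i j; rewrite !mxE.
Qed.

HB.instance Definition _ := Lmodule_hasFinDim.Build R cmat cmat_vect_iso.

Definition lie (X Y : cmat) : cmat := X *m Y - Y *m X.

Definition cconj (X : cmat) : cmat := map_mx (@conjc R) X.
Definition cscalar_tr (X : cmat) : cmat := (\tr X)%:M.
Definition addadj (X : cmat) : cmat := X + (cconj X)^T.
Definition subconj (X : cmat) : cmat := X - cconj X.
Definition addconj (X : cmat) : cmat := X + cconj X.

Fact cconj_linear : linear cconj.
Proof.
by move=> a X Y; apply/matrixP=> i j;
  rewrite !mxE rmorphD rmorphM /= oppr0.
Qed.
HB.instance Definition _ := GRing.isLinear.Build R cmat cmat _ cconj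
  cconj_linear.

Fact cscalar_tr_linear : linear cscalar_tr.
Proof.
move=> a X Y; rewrite /cscalar_tr mxtraceD mxtraceZ.
by apply/matrixP=> i j; rewrite !mxE mulrnDl mulrnAr.
Qed.
HB.instance Definition _ := GRing.isLinear.Build R cmat cmat _ cscalar_tr
  cscalar_tr_linear.

Fact addadj_linear : linear addadj.
Proof.
move=> a X Y; rewrite /addadj linearP scalerDr addrACA; congr (_ + _).
by apply/matrixP=> i j; rewrite !mxE.
Qed.
HB.instance Definition _ := GRing.isLinear.Build R cmat cmat _ addadj
  addadj_linear.

Fact subconj_linear : linear subconj.
Proof. by move=> a X Y; rewrite /subconj linearP scalerBr opprD addrACA. Qed.
HB.instance Definition _ := GRing.isLinear.Build R cmat cmat _ subconj
  subconj_linear.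

Fact addconj_linear : linear addconj.
Proof. by move=> a X Y; rewrite /addconj linearP scalerDr addrACA. Qed.
HB.instance Definition _ := GRing.isLinear.Build R cmat cmat _ addconj
  addconj_linear.

Definition su : {vspace cmat} :=
  (lker (linfun addadj) :&: lker (linfun cscalar_tr))%VS.

(* Cartan decomposition su = so (+) sq, the eigenspaces of X |-> conj X *)
Definition so : {vspace cmat} := (su :&: lker (linfun subconj))%VS.
Definition sq : {vspace cmat} := (su :&: lker (linfun addconj))%VS.

Lemma memv_su X :
  (X \in su) = ((cconj X)^T == - X :> 'M[R[i]]_n) && (\tr X == 0).
Proof.
rewrite memv_cap !memv_ker !lfunE /= /addadj addrC addr_eq0; congr (_ && _).
rewrite /cscalar_tr; case: (pickP 'I_n) => [i _|noI].
  apply/eqP/eqP => [/matrixP/(_ i i)|->]; first by rewrite !mxE eqxx.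
  by apply/matrixP=> j j'; rewrite !mxE mul0rn.
rewrite [\tr X]big_pred0 // eqxx.
by apply/eqP/matrixP=> i; have := noI i.
Qed.

Lemma memv_so X : (X \in so) = (X \in su) && (cconj X == X).
Proof. by rewrite memv_cap memv_ker lfunE /= subr_eq0 eq_sym. Qed.

Lemma memv_sq X : (X \in sq) = (X \in su) && (cconj X == - X).
Proof. by rewrite memv_cap memv_ker lfunE /= /addconj addrC addr_eq0. Qed.

Definition Q (X Y : cmat) : R := - killing lie su X Y.

(* The threefold product of su(n) lives in functions from 'I_3. *)
Local Notation cmat3 := {ffun 'I_3 -> cmat}.

Definition lie3 (X Y : cmat3) : cmat3 := [ffun i => lie (X i) (Y i)].

Definition Q3 (X Y : cmat3) : R := \sum_(i < 3) Q (X i) (Y i).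

Definition tens (t : 'I_3 -> R) (X : cmat) : cmat3 := [ffun i => t i *: X].

Fact tens_linear t : linear (tens t).
Proof.
by move=> a X Y; apply/ffunP=> i;
  rewrite !ffunE scalerDr !scalerA mulrC.
Qed.
HB.instance Definition _ t := GRing.isLinear.Build R cmat cmat3 _ (tens t)
  (tens_linear t).

Definition tensv (t : 'I_3 -> R) (U : {vspace cmat}) : {vspace cmat3} :=
  (linfun (tens t) @: U)%VS.

Definition factor (i : 'I_3) : 'I_3 -> R := fun j => (j == i)%:R.
Definition v1 : 'I_3 -> R := fun i => (Num.sqrt 2)^-1 * [:: 1; -1; 0]`_i.
Definition v2 : 'I_3 -> R := fun i => (Num.sqrt 6)^-1 * [:: 1; 1; -2]`_i.

Definition delta_so : {vspace cmat3} := tensv (fun=> 1) so.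

Definition summand (i : 'I_5) : {vspace cmat3} :=
  nth 0%VS [:: tensv (factor 0) sq; tensv (factor 1) sq; tensv (factor 2) sq;
               tensv v1 so; tensv v2 so] i.

Definition tangent : {vspace cmat3} := (\sum_(i < 5) summand i)%VS.

(* The sum defining tangent is direct; sumv_pi projects onto a summand. *)
Definition diag_metric (c : 'I_5 -> R) (X Y : cmat3) : R :=
  \sum_(i < 5) c i * Q3 (sumv_pi (\sum_(j < 5) summand j)%VS i X)
                        (sumv_pi (\sum_(j < 5) summand j)%VS i Y).

(* The metric (x, x, z, u, 1). *)
Definition metric (x z u : R) : cmat3 -> cmat3 -> R :=
  diag_metric (fun i => [:: x; x; z; u; 1]`_i).

End ComplexMatrices.

Definition is_einstein_metric (R : realType) (n : nat) (x z u : R) : Prop :=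
  einstein (@lie3 R n) (delta_so R n) (tangent R n) (@metric R n x z u).

(* Main.v *)
From Stdlib Require Import ZArith.
Require Import Defs.
From HB Require Import structures.
From mathcomp Require Import all_boot all_order all_algebra.
From mathcomp Require Import reals complex ring lra zify ssrZ.
Set Implicit Arguments.
Unset Strict Implicit.
Unset Printing Implicit Defensive.
Import Order.TTheory GRing.Theory Num.Theory.
Local Open Scope ring_scope.

(** The Lie algebra su splits as so + sq, and the tangent space of SU(n)^3 / SO(n)
    is a sum of three copies of sq and two copies of so, each embedded in su^3 by a
    weight vector of R^3.  The bracket of two copies is, in each copy, a rational
    multiple of the bracket of su; the Koszul formula then shows that the
    Levi-Civita connection of a metric (x, x, z, u, 1) has the same form, with other
    coefficients (lc_conn_levi_civita).  So the trace defining the Ricci tensor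
    reduces to the traces of ad y ad z on so and on sq, which are known multiples of
    the Killing form (vtrace_graded).  The outcome is that the Ricci tensor is
    diagonal, with four eigenvalues relative to the metric that are explicit
    rational functions of x, z, u and n; the metric is Einstein when they coincide
    (einstein_metricE).

    Put w = u / x and y = u / z.  One of the three resulting equations is linear in u and
    gives u = nu_poly / (6 m_poly), where both are quadratic in w.  Elimination of
    y ^+ 2 from the other two expresses w - y as 1 - u times a function of u and w;
    substituting this back and dividing by 1 - u leaves one equation in u and w
    (system_reduced).  Replacing u there by its value yields a polynomial g_poly of
    degree ten in w whose coefficients are polynomials in n (g_poly_reduced).  Since
    y ^+ 2 > 0 forces u > 1/3, a solution has w either between
    (n - 2) / (3n + 2) and (n - 2) / (n + 1) or between 1 and 3 (system_region).
    In each of these two ranges g_poly has exactly one root, the first with u < 1 and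
    the second with u > 1, and both yield x, z, u > 0 (left_root_unique,
    left_root_exists and their counterparts on the right).

    The statements about g_poly hold for all n >= 3 because, on suitable subintervals
    with endpoints rational in n, the substitutions n = 3 + m and
    w = (lo + t hi) / (1 + t) turn g_poly into a polynomial in t, m >= 0 whose coefficients all
    have the same sign, or all but those of t^0; this gives the sign of g_poly, or its
    monotonicity, and is checked by computing the coefficients (bp_pos_gt0,
    bp_eval_lt). *)

(** * Traces on a subspace *)
Section Trace.
Variables (F : fieldType) (V : vectType F).
Implicit Types (U : {vspace V}) (f g : V -> V).

Lemma eq_in_vtrace U f g : {in U, f =1 g} -> vtrace U f = vtrace U g.
Proof.
by move=> fg; apply: eq_bigr => i _; rewrite fg // vbasis_mem // mem_nth ?size_tuple.
Qed.

Lemma vtraceD U f g : vtrace U (fun X => f X + g X) = vtrace U f + vtrace U g.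
Proof. by rewrite -big_split; apply: eq_bigr => i _; rewrite linearD. Qed.

Lemma vtraceZ U a f : vtrace U (fun X => a *: f X) = a * vtrace U f.
Proof. by rewrite mulr_sumr; apply: eq_bigr => i _; rewrite linearZ. Qed.

Lemma vtrace_sum U (I : finType) (f : I -> V -> V) :
  vtrace U (fun X => \sum_i f i X) = \sum_i vtrace U (f i).
Proof.
by rewrite exchange_big; apply: eq_bigr => i _; rewrite linear_sum.
Qed.

(** A frame for U is a family e with linear functionals l such that every X in U
    is the sum of the l i X *: e i; it need not be free.  The trace can be read
    off any frame, so matrix units can be used over all ordered pairs of
    indices, and a direct sum can be handled through its summands.  The proof
    expands the basis vectors in the frame and exchanges the sums. *)
Lemma vtrace_frame U (I : finType) (e : I -> V) (l : I -> V -> F) f :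
    linear f -> {in U, forall X, f X \in U} -> (forall i, e i \in U) ->
    (forall i, linear_for *%R (l i)) ->
    {in U, forall X, X = \sum_i l i X *: e i} ->
  vtrace U f = \sum_i l i (f (e i)).
Proof.
move=> f_lin fU eU l_lin frame.
pose fl : {linear V -> V} := HB.pack f (GRing.isLinear.Build F V V *:%R f f_lin).
pose ll i : {linear V -> F | *%R} :=
  HB.pack (l i) (GRing.isLinear.Build F V F *%R (l i) (l_lin i)).
transitivity (\sum_(j < \dim U) \sum_i l i (vbasis U)`_j * coord (vbasis U) j (f (e i))).
  apply: eq_bigr => j _; have bj : (vbasis U)`_j \in U.
    by rewrite vbasis_mem // mem_nth ?size_tuple.
  rewrite {1}(frame _ bj) -[f _]/(fl _) 2!linear_sum; apply: eq_bigr => i _.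
  by rewrite !linearZ.
rewrite exchange_big; apply: eq_bigr => i _.
rewrite [in RHS](coord_vbasis (fU _ (eU i))) -[l i (\sum_(j < _) _)]/(ll i _) linear_sum.
by apply: eq_bigr => j _; rewrite linearZ /= mulrC.
Qed.

End Trace.

(** * The Lie algebra su and its Cartan decomposition *)
Section SpecialUnitary.
Variables (R : realType) (n : nat).
Local Notation cmat := (cmat R n).
Local Notation M := 'M[R[i]]_n.
Local Notation su := (su R n).
Local Notation so := (so R n).
Local Notation sq := (sq R n).
Local Notation lie := (@lie R n).
Local Notation Q := (@Q R n).

Lemma lieC (X Y : cmat) : lie X Y = - lie Y X.
Proof. by rewrite /Defs.lie opprB. Qed.

Lemma lieDl (X X' Y : cmat) : lie (X + X') Y = lie X Y + lie X' Y.
Proof. by rewrite /Defs.lie mulmxDl mulmxDr opprD addrACA. Qed.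

Lemma lieZl a (X Y : cmat) : lie (a *: X) Y = a *: lie X Y.
Proof.
rewrite /Defs.lie -scalemxAl -scalemxAr.
by apply/matrixP => i j; rewrite !mxE mulrBr.
Qed.

Lemma lieDr (X Y Y' : cmat) : lie X (Y + Y') = lie X Y + lie X Y'.
Proof. by rewrite lieC lieDl opprD -!(lieC X). Qed.

Lemma lieZr a (X Y : cmat) : lie X (a *: Y) = a *: lie X Y.
Proof. by rewrite lieC lieZl -scalerN -lieC. Qed.

Lemma lieNr (X Y : cmat) : lie X (- Y) = - lie X Y.
Proof. by rewrite /Defs.lie mulmxN mulNmx opprB opprK addrC. Qed.

Lemma lieBr (X Y Y' : cmat) : lie X (Y - Y') = lie X Y - lie X Y'.
Proof. by rewrite lieDr lieNr. Qed.

Lemma lie_jacobi (X Y Z : cmat) :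
  lie (lie X Y) Z = lie X (lie Y Z) - lie Y (lie X Z).
Proof.
rewrite /Defs.lie !(mulmxBl, mulmxBr) !mulmxA.
move: (X *m Y *m Z) (Y *m X *m Z) (Z *m X *m Y) (Z *m Y *m X) => a b c d.
move: (X *m Z *m Y) (Y *m Z *m X) => e f.
by apply/matrixP => i j; rewrite !mxE; ring.
Qed.

Lemma soP (X : cmat) :
  X \in so = [&& X^T == - X :> M, map_mx (@conjc R) X == X & \tr X == 0].
Proof.
rewrite memv_so memv_su /cconj.
by have [->|_] := eqVneq (map_mx (@conjc R) X) X; rewrite ?andbF ?andbT.
Qed.

Lemma sqP (X : cmat) :
  X \in sq = [&& X^T == X :> M, map_mx (@conjc R) X == - X & \tr X == 0].
Proof.
rewrite memv_sq memv_su /cconj.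
have [->|_] := eqVneq (map_mx (@conjc R) X) (- X); rewrite ?andbF ?andbT //.
by rewrite linearN /= eqr_opp.
Qed.

(** The next two sums evaluate the traces of X |-> A X B and of
    X |-> A X^T B on all matrices; they are the only traces needed, because the
    frames of so and sq are (anti)symmetrised matrix units. *)
Lemma sum_tr_delta (A B : M) :
  \sum_i \sum_j (A *m delta_mx i j *m B) i j = \tr A * \tr B.
Proof.
rewrite mulr_suml; apply: eq_bigr => i _; rewrite mulr_sumr; apply: eq_bigr => j _.
rewrite mxE (bigD1 j) //= big1 ?addr0 => [|k kj].
  rewrite mxE (bigD1 i) //= big1 ?addr0 => [|k ki].
    by rewrite mxE !eqxx mulr1.
  by rewrite mxE (negPf ki) mulr0.
by rewrite mxE big1 ?mul0r // => l _; rewrite mxE (negPf kj) andbF mulr0.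
Qed.

Lemma sum_tr_deltaT (A B : M) :
  \sum_i \sum_j (A *m delta_mx j i *m B) i j = \tr (A *m B^T).
Proof.
apply: eq_bigr => i _; rewrite mxE; apply: eq_bigr => j _.
rewrite mxE (bigD1 i) //= big1 ?addr0 => [|k ki].
  rewrite mxE (bigD1 j) //= big1 ?addr0 => [|k kj].
    by rewrite !mxE !eqxx mulr1.
  by rewrite mxE (negPf kj) mulr0.
by rewrite mxE big1 ?mul0r // => l _; rewrite mxE (negPf ki) andbF mulr0.
Qed.

Lemma lie_lieE (A B X : cmat) i j :
  lie A (lie B X) i j =
    (A *m B *m X *m 1%:M) i j - (A *m X *m B) i j - (B *m X *m A) i j
    + (1%:M *m X *m (B *m A)) i j.
Proof.
rewrite /Defs.lie !(mulmxBl, mulmxBr) !mulmxA !mulmx1 !mul1mx.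
move: (A *m B *m X) (A *m X *m B) (B *m X *m A) (X *m B *m A) => a b c d.
by rewrite !mxE; ring.
Qed.

Lemma sum_lie_delta (A B : cmat) : \tr A = 0 ->
  \sum_i \sum_j lie A (lie B (delta_mx i j)) i j = (2 * n)%:R * \tr (A *m B).
Proof.
move=> A0; under eq_bigr do under eq_bigr do rewrite lie_lieE.
under eq_bigr do rewrite !big_split /= !sumrN.
rewrite !big_split /= !sumrN !sum_tr_delta A0 mxtrace1 (mxtrace_mulC B).
by rewrite natrM; ring.
Qed.

Lemma sum_lie_deltaT (A B : cmat) :
  \sum_i \sum_j lie A (lie B (delta_mx j i)) i j
    = 2 * (\tr (A *m B) - \tr (A *m B^T)).
Proof.
under eq_bigr do under eq_bigr do rewrite lie_lieE.
under eq_bigr do rewrite !big_split /= !sumrN.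
rewrite !big_split /= !sumrN !sum_tr_deltaT trmx1 mulmx1 mul1mx.
rewrite mxtrace_tr (mxtrace_mulC B A) -(mxtrace_tr (B *m _)) trmx_mul trmxK.
by ring.
Qed.

Lemma lie_lin X : linear (lie X).
Proof. by move=> a Y Z; rewrite lieDr lieZr. Qed.

Lemma lie_lie_lin X Y : linear (fun Z => lie X (lie Y Z)).
Proof. by move=> a Z T; rewrite !lie_lin. Qed.

(** Frames of so and sq indexed by all ordered pairs (j, k): each element of so is
    half the sum of its real entries times so_frame, each element of sq is half
    the sum of its imaginary entries times sq_frame.  The scalar matrix makes
    sq_frame traceless on the diagonal. *)
Definition so_frame (jk : 'I_n * 'I_n) : cmat :=
  delta_mx jk.1 jk.2 - delta_mx jk.2 jk.1.

Definition sym_unit (jk : 'I_n * 'I_n) : 'M[R]_n :=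
  delta_mx jk.1 jk.2 + delta_mx jk.2 jk.1 - ((jk.1 == jk.2)%:R * (2 / n%:R))%:M.

Definition sq_frame (jk : 'I_n * 'I_n) : cmat :=
  'i%C *: map_mx (real_complex R) (sym_unit jk).

Definition re_entry (jk : 'I_n * 'I_n) (X : cmat) : R := complex.Re (X jk.1 jk.2) / 2.
Definition im_entry (jk : 'I_n * 'I_n) (X : cmat) : R := complex.Im (X jk.1 jk.2) / 2.

Lemma re_entry_lin jk : linear_for *%R (re_entry jk).
Proof.
move=> a X Y; rewrite /re_entry mxE cmat_scaleE.
by case: (X _ _) (Y _ _) => [b c] [d e] /=; ring.
Qed.

Lemma im_entry_lin jk : linear_for *%R (im_entry jk).
Proof.
move=> a X Y; rewrite /im_entry mxE cmat_scaleE.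
by case: (X _ _) (Y _ _) => [b c] [d e] /=; ring.
Qed.

Lemma so_frame_in jk : so_frame jk \in so.
Proof.
rewrite soP /so_frame; apply/and3P; split.
- by rewrite linearB /= !trmx_delta opprB.
- by rewrite map_mxB !map_delta_mx.
- by rewrite linearB /= -[delta_mx jk.2 _]trmx_delta mxtrace_tr subrr.
Qed.

Lemma trace_delta (S : nzRingType) (j k : 'I_n) : \tr (delta_mx j k : 'M[S]_n) = (j == k)%:R.
Proof.
rewrite /mxtrace (bigD1 j) //= big1 ?addr0 => [|i ij]; rewrite mxE ?eqxx //.
by rewrite (negPf ij).
Qed.

Lemma sq_frame_in jk : (0 < n)%N -> sq_frame jk \in sq.
Proof.
move=> n0; have nC : n%:R != 0 :> R by rewrite pnatr_eq0 -lt0n.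
rewrite sqP /sq_frame; apply/and3P; split.
- rewrite linearZ /= map_trmx /sym_unit linearB linearD /= !trmx_delta tr_scalar_mx.
  by rewrite [X in map_mx _ (X - _)]addrC eqxx.
- apply/eqP/matrixP => i j; rewrite [RHS]mxE [LHS]mxE [sq_frame _ _ _]mxE [map_mx _ _ _ _]mxE.
  by apply/eqP; rewrite eq_complex /=; apply/andP; split; apply/eqP; ring.
- rewrite linearZ /= trace_map_mx /sym_unit linearB linearD /= !trace_delta mxtrace_scalar.
  rewrite [jk.2 == _]eq_sym -[(_ * (2 / _)) *+ n]mulr_natr -mulrA divfK // mulr_natr -mulr2n.
  by rewrite subrr rmorph0 mulr0.
Qed.

Lemma sum_delta_entry (c : 'I_n -> 'I_n -> R[i]) a b :
  \sum_j \sum_k c j k * ((a == j) && (b == k))%:R = c a b.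
Proof.
have /(congr1 (fun A : M => A a b)) := matrix_sum_delta (\matrix_(j, k) c j k : M).
rewrite mxE => ->; rewrite summxE; apply: eq_bigr => j _.
by rewrite summxE; apply: eq_bigr => k _; rewrite !mxE.
Qed.

Lemma sum_deltaT_entry (c : 'I_n -> 'I_n -> R[i]) a b :
  \sum_j \sum_k c j k * ((a == k) && (b == j))%:R = c b a.
Proof. by rewrite exchange_big (sum_delta_entry (fun k j => c j k)). Qed.

Lemma so_frameE X : X \in so -> X = \sum_jk re_entry jk X *: so_frame jk.
Proof.
rewrite soP => /and3P[/eqP XT /eqP Xc _].
have Xre j k : (complex.Re (X j k))%:C%C = X j k.
  have := congr1 (fun A : M => A j k) Xc; rewrite mxE.
  by case: (X j k) => a b /= [/esym/eqP]; rewrite -addr_eq0 -mulr2n mulrn_eq0 /= => /eqP ->.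
have XTE j k : X k j = - X j k.
  by have := congr1 (fun A : M => A j k) XT; rewrite !mxE.
apply/matrixP => a b; rewrite summxE -(pair_bigA _ (fun j k => (re_entry (j, k) X *: so_frame (j, k)) a b)) /=.
under eq_bigr do under eq_bigr do
  rewrite cmat_scaleE /re_entry /so_frame /= !mxE rmorphM /= Xre mulrBr.
under eq_bigr do rewrite sumrB.
rewrite sumrB; set h := (_^-1)%:C%C.
have /= -> := sum_delta_entry (fun j k => X j k * h) a b.
have /= -> := sum_deltaT_entry (fun j k => X j k * h) a b.
rewrite [X b a]XTE mulNr opprK -mulrDr -rmorphD.
have -> : 2^-1 + 2^-1 = 1 :> R by field.
by rewrite rmorph1 mulr1.
Qed.

Lemma sq_frameE X : (0 < n)%N -> X \in sq -> X = \sum_jk im_entry jk X *: sq_frame jk.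
Proof.
move=> n0; rewrite sqP => /and3P[/eqP XT /eqP Xc /eqP X0].
have Xim j k : 'i%C * (complex.Im (X j k))%:C%C = X j k.
  have := congr1 (fun A : M => A j k) Xc; rewrite !mxE.
  case: (X j k) => a b /= [/eqP]; rewrite -addr_eq0 -mulr2n mulrn_eq0 /= => /eqP ->.
  by apply/eqP; rewrite eq_complex /=; apply/andP; split; apply/eqP; ring.
have XTE j k : X k j = X j k.
  by have := congr1 (fun A : M => A j k) XT; rewrite !mxE.
apply/matrixP => a b; rewrite summxE.
rewrite -(pair_bigA _ (fun j k => (im_entry (j, k) X *: sq_frame (j, k)) a b)) /=.
have E j k : (im_entry (j, k) X *: sq_frame (j, k)) a b
   = X j k * (2^-1)%:C%C * ((a == j) && (b == k))%:R
     + X j k * (2^-1)%:C%C * ((a == k) && (b == j))%:R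
     - (j == k)%:R * (X j k * (n%:R^-1)%:C%C * (a == b)%:R).
  have Xy := Xim j k; rewrite cmat_scaleE /im_entry /sq_frame /=; set y := complex.Im _ in Xy *.
  rewrite -[in RHS]Xy !mxE !(rmorphM, rmorphB, rmorphD, rmorphMn, rmorph_nat) /=.
  rewrite -[_ *+ (a == b)]mulr_natr; field.
  by rewrite pnatr_eq0 -lt0n.
under eq_bigr do under eq_bigr do rewrite E.
under eq_bigr do rewrite sumrB big_split.
rewrite sumrB big_split /=; set h := (2^-1)%:C%C.
have /= -> := sum_delta_entry (fun j k => X j k * h) a b.
have /= -> := sum_deltaT_entry (fun j k => X j k * h) a b.
rewrite [X b a]XTE.
rewrite [X in _ - X](_ : _ = 0) ?subr0.
  rewrite -mulrDr -rmorphD.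
  have -> : 2^-1 + 2^-1 = 1 :> R by field.
  by rewrite rmorph1 mulr1.
under eq_bigr => j _.
  rewrite (bigD1 j) //= big1 ?addr0; last by move=> k /negPf kj; rewrite eq_sym kj mul0r.
  rewrite eqxx mul1r -mulrA; over.
by rewrite -mulr_suml -[\sum_(i < n) _]/(\tr (X : M)) X0 mul0r.
Qed.

Lemma ReD (x y : R[i]) : complex.Re (x + y) = complex.Re x + complex.Re y.
Proof. by case: x y => [a b] [c d]. Qed.

Lemma ReN (x : R[i]) : complex.Re (- x) = - complex.Re x.
Proof. by case: x. Qed.

Lemma ReM_nat m (x : R[i]) : complex.Re (m%:R * x) = m%:R * complex.Re x.
Proof. by rewrite mulr_natl mulr_natl; elim: m => //= m IH; rewrite !mulrS ReD IH. Qed.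

Lemma Re_sum (I : finType) (F : I -> R[i]) :
  complex.Re (\sum_i F i) = \sum_i complex.Re (F i).
Proof. exact: (big_morph _ ReD). Qed.

Lemma sum_pair (F : 'I_n * 'I_n -> R) : \sum_jk F jk = \sum_j \sum_k F (j, k).
Proof. by rewrite (pair_bigA _ (fun j k => F (j, k))); apply: eq_bigr => -[]. Qed.

Definition Rtr (X Y : cmat) : R := complex.Re (\tr (X *m Y)).

Lemma RtrC X Y : Rtr X Y = Rtr Y X.
Proof. by rewrite /Rtr mxtrace_mulC. Qed.

Lemma cmat_subE (A B : cmat) i j : (A - B) i j = A i j - B i j.
Proof. by rewrite !mxE. Qed.

(* Otherwise unification compares brackets by unfolding them to matrix entries. *)
Local Opaque Defs.lie.

Lemma lie_so_frame A B jk : lie A (lie B (so_frame jk)) =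
  lie A (lie B (delta_mx jk.1 jk.2)) - lie A (lie B (delta_mx jk.2 jk.1)).
Proof. exact: etrans (congr1 (lie A) (lieBr B _ _)) (lieBr A _ _). Qed.

Local Opaque so_frame sq_frame.

Lemma sum_so_frame A B : \tr A = 0 ->
  \sum_jk re_entry jk (lie A (lie B (so_frame jk)))
    = (n%:R - 1) * Rtr A B + complex.Re (\tr (A *m B^T)).
Proof.
move=> A0; rewrite sum_pair.
transitivity (2^-1 * complex.Re (\sum_i \sum_j lie A (lie B (delta_mx i j)) i j
                              - \sum_i \sum_j lie A (lie B (delta_mx j i)) i j)).
  rewrite -sumrB Re_sum mulr_sumr; apply: eq_bigr => i _.
  rewrite -sumrB Re_sum mulr_sumr; apply: eq_bigr => j _.
  rewrite /re_entry [RHS]mulrC; congr (complex.Re _ / 2).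
  rewrite -cmat_subE.
  have E := lie_so_frame A B (i, j).
  exact: (congr1 (fun X : cmat => X i j) E).
transitivity (2^-1 * complex.Re ((2 * n)%:R * \tr (A *m B)
                                - 2 * (\tr (A *m B) - \tr (A *m B^T)))).
  congr (_ * complex.Re (_ - _)); first exact: sum_lie_delta.
  exact: sum_lie_deltaT.
by rewrite ReD ReN !ReM_nat ReD ReN natrM /Rtr; field.
Qed.

Local Transparent Defs.lie so_frame sq_frame.
Lemma lieZc (a : R[i]) A (B : M) : lie A (a *: B) = a *: (lie A B : M).
Proof. by rewrite /Defs.lie -scalemxAl -scalemxAr scalerBr. Qed.

Lemma lie_scalar A a : lie A a%:M = 0.
Proof. by rewrite /Defs.lie scalar_mxC subrr. Qed.

Lemma Im_imul (z : R[i]) : complex.Im ('i%C * z) = complex.Re z.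
Proof. by case: z => a b /=; rewrite mul0r mul1r add0r. Qed.

Lemma cmat_addE (A B : cmat) i j : (A + B) i j = A i j + B i j.
Proof. by rewrite !mxE. Qed.

Lemma cmat_scalecE (a : R[i]) (A : M) i j : (a *: A) i j = a * A i j.
Proof. by rewrite !mxE. Qed.

Lemma lie_sq_frame A B jk : lie A (lie B (sq_frame jk)) =
  'i%C *: (lie A (lie B (delta_mx jk.1 jk.2))
           + lie A (lie B (delta_mx jk.2 jk.1)) : M).
Proof.
have -> : lie B (sq_frame jk) =
    'i%C *: (lie B (delta_mx jk.1 jk.2) + lie B (delta_mx jk.2 jk.1) : M).
  rewrite /sq_frame /sym_unit map_mxB map_mxD !map_delta_mx map_scalar_mx.
  apply: etrans (lieZc _ _ _) (congr1 (fun X : M => _ *: X) _).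
  apply: etrans (lieBr _ _ _) _; rewrite -[RHS]subr0.
  by congr (_ - _); [exact: lieDr | exact: lie_scalar].
by apply: etrans (lieZc _ _ _) (congr1 (fun X : M => _ *: X) _); exact: lieDr.
Qed.

Local Opaque Defs.lie so_frame sq_frame.

Lemma sum_sq_frame A B : \tr A = 0 ->
  \sum_jk im_entry jk (lie A (lie B (sq_frame jk)))
    = (n%:R + 1) * Rtr A B - complex.Re (\tr (A *m B^T)).
Proof.
move=> A0; rewrite sum_pair.
transitivity (2^-1 * complex.Re (\sum_i \sum_j lie A (lie B (delta_mx i j)) i j
                              + \sum_i \sum_j lie A (lie B (delta_mx j i)) i j)).
  rewrite -big_split Re_sum mulr_sumr; apply: eq_bigr => i _ /=.
  rewrite -big_split Re_sum mulr_sumr; apply: eq_bigr => j _ /=.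
  rewrite /im_entry [RHS]mulrC; congr (_ / 2).
  have E := lie_sq_frame A B (i, j).
  have := congr1 (fun X : cmat => complex.Im (X i j)) E.
  by rewrite cmat_scalecE Im_imul cmat_addE.
transitivity (2^-1 * complex.Re ((2 * n)%:R * \tr (A *m B)
                                + 2 * (\tr (A *m B) - \tr (A *m B^T)))).
  congr (_ * complex.Re (_ + _)); first exact: sum_lie_delta.
  exact: sum_lie_deltaT.
by rewrite !ReD !ReM_nat ReD ReN natrM /Rtr; field.
Qed.

(** so and sq as the even and odd parts of a grading by bool, so that statements
    about brackets, projections and traces need not distinguish them. *)
Definition graded (odd : bool) : {vspace cmat} := if odd then sq else so.

Lemma gradedP o X : X \in graded o =
  [&& X^T == (-1) ^+ (~~ o) *: (X : M), map_mx (@conjc R) X == (-1) ^+ o *: (X : M)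
    & \tr X == 0].
Proof. by case: o; rewrite /graded ?soP ?sqP !(expr1, expr0) scaleN1r scale1r. Qed.

Lemma graded_tr0 o X : X \in graded o -> \tr X = 0.
Proof. by rewrite gradedP => /and3P[_ _ /eqP]. Qed.

Local Transparent Defs.lie.
Lemma trmx_lie (X Y : M) : (lie X Y)^T = Y^T *m X^T - X^T *m Y^T.
Proof. by rewrite -!trmx_mul; exact: (linearB _). Qed.

Lemma conj_lie (X Y : M) : map_mx (@conjc R) (lie X Y) =
  map_mx (@conjc R) X *m map_mx (@conjc R) Y - map_mx (@conjc R) Y *m map_mx (@conjc R) X.
Proof. by rewrite -!map_mxM; exact: map_mxB. Qed.

Lemma lie_tr (X Y : M) : \tr (lie X Y) = 0.
Proof. by apply: etrans (linearB _ _ _) _; rewrite /= mxtrace_mulC subrr. Qed.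

Local Opaque Defs.lie.
Lemma lie_graded o o' X Y :
  X \in graded o -> Y \in graded o' -> lie X Y \in graded (o (+) o').
Proof.
rewrite !gradedP => /and3P[/eqP XT /eqP Xc _] /and3P[/eqP YT /eqP Yc _].
have sgnE (b b' : bool) : (-1) ^+ b * (-1) ^+ b' = (-1) ^+ (b (+) b') :> R[i].
  by rewrite -signr_addb.
have lieT : (lie X Y)^T = (-1) ^+ (~~ o (+) ~~ o') *: (Y *m X - X *m Y).
  by rewrite trmx_lie XT YT -!scalemxAl -!scalemxAr !scalerA !sgnE [~~ o' (+) _]addbC scalerBr.
have lie_conj : map_mx (@conjc R) (lie X Y) = (-1) ^+ (o (+) o') *: (X *m Y - Y *m X).
  by rewrite conj_lie Xc Yc -!scalemxAl -!scalemxAr !scalerA !sgnE [o' (+) o]addbC scalerBr.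
apply/and3P; split; first 1 last.
- by rewrite lie_conj.
- by rewrite lie_tr.
rewrite lieT -opprB scalerN -scaleNr; apply/eqP; congr (_ *: _).
by rewrite -[- _]mulN1r -[-1]/((-1) ^+ true) sgnE; case: (o) (o') => [] [].
Qed.

Lemma vtrace_so A B : \tr A = 0 -> {in so, forall X, lie A (lie B X) \in so} ->
  vtrace so (fun X => lie A (lie B X))
    = (n%:R - 1) * Rtr A B + complex.Re (\tr (A *m B^T)).
Proof.
move=> A0 so_stable; rewrite -sum_so_frame //; apply: vtrace_frame => //.
- exact: lie_lie_lin.
- exact: so_frame_in.
- exact: re_entry_lin.
- exact: so_frameE.
Qed.

Lemma vtrace_sq A B : (0 < n)%N -> \tr A = 0 ->
    {in sq, forall X, lie A (lie B X) \in sq} ->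
  vtrace sq (fun X => lie A (lie B X))
    = (n%:R + 1) * Rtr A B - complex.Re (\tr (A *m B^T)).
Proof.
move=> n0 A0 sq_stable; rewrite -sum_sq_frame //; apply: vtrace_frame => //.
- exact: lie_lie_lin.
- by move=> jk; apply: sq_frame_in.
- exact: im_entry_lin.
- by move=> X; apply: sq_frameE.
Qed.

Local Opaque Defs.lie so_frame sq_frame.

Lemma lieDD (X X' Y Y' : cmat) :
  lie (X + X') (Y + Y') = lie X Y + lie X Y' + (lie X' Y + lie X' Y').
Proof. by rewrite lieDl; congr (_ + _); exact: lieDr. Qed.

(** Complex conjugation acts as 1 on so and as -1 on sq, which gives the
    projections globally as linear maps of matrices. *)
Definition gproj (odd : bool) (X : cmat) : cmat :=
  2^-1 *: (X + (-1) ^+ odd *: cconj X).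

Lemma cconj_graded o X : X \in graded o -> cconj X = (-1) ^+ o *: X.
Proof.
case: o; rewrite /graded ?memv_so ?memv_sq => /andP[_ /eqP ->].
  by rewrite expr1 scaleN1r.
by rewrite expr0 scale1r.
Qed.

Lemma gproj_lin o : linear (gproj o).
Proof.
move=> a X Y; rewrite /gproj linearP [in RHS]scalerA [a * _]mulrC -scalerA -scalerDr.
by congr (_ *: _); rewrite !scalerDr addrACA !scalerA [_ * a]mulrC.
Qed.
HB.instance Definition _ o := GRing.isLinear.Build R cmat cmat _ (gproj o)
  (gproj_lin o).

Lemma gproj_sum X : X = gproj false X + gproj true X.
Proof.
rewrite /gproj -scalerDr addrACA -scalerDl expr0 expr1 subrr scale0r addr0.
by rewrite -[X in X + _]scale1r -[X in _ + X]scale1r -scalerDl scalerA mulVf ?pnatr_eq0 ?scale1r.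
Qed.

Lemma gproj_graded o o' X : X \in graded o' -> gproj o X = (o == o')%:R *: X.
Proof.
move=> Xo; rewrite /gproj (cconj_graded Xo) scalerA -signr_addb.
rewrite -[X in X + _]scale1r -scalerDl scalerA; congr (_ *: _).
by case: o o' {Xo} => [] []; rewrite /= ?(expr0, expr1) ?subrr ?mulr0 // mulVf ?pnatr_eq0.
Qed.

Lemma graded_su o : {subset graded o <= su}.
Proof. by case: o => X; rewrite /graded ?memv_so ?memv_sq => /andP[]. Qed.

Lemma gproj_in o X : X \in su -> gproj o X \in graded o.
Proof.
move=> Xsu; have cXsu : cconj X \in su.
  move: Xsu; rewrite !memv_su => /andP[/eqP XT /eqP X0]; apply/andP; split.
    apply/eqP; have /= := congr1 (fun Y : M => map_mx (@conjc R) Y) XT.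
    by rewrite -map_trmx map_mxN.
  by rewrite /cconj trace_map_mx X0 rmorph0.
have Psu : gproj o X \in su by rewrite rpredZ // rpredD // rpredZ.
have cK : cconj (cconj X) = X.
  by apply/matrixP=> i j; rewrite !mxE conjcK.
have cP : cconj (gproj o X) = (-1) ^+ o *: gproj o X.
  rewrite /gproj linearZ /= linearD linearZ /= cK scalerA mulrC -scalerA; congr (_ *: _).
  by rewrite scalerDr scalerA -signr_addb addbb expr0 scale1r addrC.
by case: o Psu cP => Psu cP; rewrite /graded ?memv_so ?memv_sq Psu cP ?expr1 ?scaleN1r ?expr0 ?scale1r eqxx.
Qed.

Lemma lie_su X Y : X \in su -> Y \in su -> lie X Y \in su.
Proof.
move=> Xsu Ysu; rewrite (gproj_sum X) (gproj_sum Y).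
have lie_in o o' : lie (gproj o X) (gproj o' Y) \in su.
  by apply: graded_su (lie_graded (gproj_in o Xsu) (gproj_in o' Ysu)).
by rewrite lieDD; apply: rpredD; apply: rpredD.
Qed.

Lemma re_entryE jk X : re_entry jk X = complex.Re (X jk.1 jk.2) / 2.
Proof. by []. Qed.

Lemma im_entryE jk X : im_entry jk X = complex.Im (X jk.1 jk.2) / 2.
Proof. by []. Qed.

Lemma re_entryD jk X Y : re_entry jk (X + Y) = re_entry jk X + re_entry jk Y.
Proof. by have := re_entry_lin jk 1 X Y; rewrite scale1r mul1r. Qed.

Lemma im_entryD jk X Y : im_entry jk (X + Y) = im_entry jk X + im_entry jk Y.
Proof. by have := im_entry_lin jk 1 X Y; rewrite scale1r mul1r. Qed.

Local Opaque gproj re_entry im_entry.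

(** The union of the frames of so and sq is a frame of su; the two sums over
    transposed matrix units cancel, leaving 2n Re tr(A B). *)
Lemma vtrace_su A B : (0 < n)%N -> A \in su -> B \in su ->
  vtrace su (fun X => lie A (lie B X)) = 2 * n%:R * Rtr A B.
Proof.
move=> n0 Asu Bsu.
have A0 : \tr A = 0 by move: Asu; rewrite memv_su => /andP[_ /eqP].
pose e (p : ('I_n * 'I_n) + ('I_n * 'I_n)) :=
  match p with inl jk => so_frame jk | inr jk => sq_frame jk end.
pose l (p : ('I_n * 'I_n) + ('I_n * 'I_n)) :=
  match p with inl jk => re_entry jk | inr jk => im_entry jk end.
rewrite (@vtrace_frame _ _ _ _ e l).
- rewrite big_sumType /= sum_so_frame // sum_sq_frame //; ring.
- exact: lie_lie_lin.
- by move=> X Xsu; rewrite !lie_su.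
- case=> jk /=.
    have so_jk : so_frame jk \in graded false by exact: so_frame_in.
    exact: graded_su so_jk.
  have sq_jk : sq_frame jk \in graded true by exact: sq_frame_in.
  exact: graded_su sq_jk.
- by case=> jk; [exact: re_entry_lin | exact: im_entry_lin].
move=> X Xsu; rewrite big_sumType /=.
have X0 := gproj_in false Xsu; have X1 := gproj_in true Xsu.
have re0 jk : re_entry jk (gproj true X) = 0.
  move: X1; rewrite /graded sqP => /and3P[_ /eqP Xc _].
  have := congr1 (fun A : M => complex.Re (A jk.1 jk.2)) Xc; rewrite re_entryE !mxE.
  by case: (fun_of_matrix _ _ _) => a b /= /eqP; rewrite -addr_eq0 -mulr2n mulrn_eq0 /= => /eqP ->; rewrite mul0r.
have im0 jk : im_entry jk (gproj false X) = 0.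
  move: X0; rewrite /graded soP => /and3P[_ /eqP Xc _].
  have := congr1 (fun A : M => complex.Im (A jk.1 jk.2)) Xc; rewrite im_entryE !mxE.
  by case: (fun_of_matrix _ _ _) => a b /= /esym/eqP; rewrite -addr_eq0 -mulr2n mulrn_eq0 /= => /eqP ->; rewrite mul0r.
have reE jk : re_entry jk X = re_entry jk (gproj false X).
  apply: etrans (congr1 (re_entry jk) (gproj_sum X)) (etrans (re_entryD _ _ _) _).
  exact: etrans (congr1 (+%R _) (re0 jk)) (addr0 _).
have imE jk : im_entry jk X = im_entry jk (gproj true X).
  apply: etrans (congr1 (im_entry jk) (gproj_sum X)) (etrans (im_entryD _ _ _) _).
  exact: etrans (congr1 (+%R^~ _) (im0 jk)) (add0r _).
rewrite {1}(gproj_sum X) {1}(so_frameE X0) {1}(sq_frameE n0 X1).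
by congr (_ + _); apply: eq_bigr => jk _; rewrite ?reE ?imE.
Qed.

(** The negative Killing form of su, as a bilinear form on all matrices. *)
Definition kform (X Y : cmat) : R := - (2 * n%:R * Rtr X Y).

Lemma Q_kform X Y : (0 < n)%N -> X \in su -> Y \in su -> Q X Y = kform X Y.
Proof. by move=> n0 Xsu Ysu; rewrite /Defs.Q /killing vtrace_su. Qed.

Lemma kformC X Y : kform X Y = kform Y X.
Proof. by rewrite /kform RtrC. Qed.

Lemma kform_linl Y : linear_for *%R (kform^~ Y).
Proof.
move=> a X X'; rewrite /kform /Rtr.
have -> : \tr ((a *: X + X') *m Y) = a%:C%C * \tr (X *m Y) + \tr (X' *m Y).
  by rewrite mulmxDl mxtraceD -scalemxAl mxtraceZ.
by rewrite ReD; case: (\tr (X *m Y)) => b c /=; ring.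
Qed.

Lemma kformZl s X Y : kform (s *: X) Y = s * kform X Y.
Proof.
have := kform_linl Y s X 0; rewrite addr0 => ->.
by rewrite [kform 0 Y]/kform /Rtr mul0mx mxtrace0 mulr0 oppr0 addr0.
Qed.

Local Transparent Defs.lie.
Lemma kform_lie X Y Z : kform (lie X Y) Z = kform X (lie Y Z).
Proof.
rewrite /kform /Rtr; congr (- (_ * complex.Re _)).
have -> : lie X Y *m Z = X *m Y *m Z - Y *m X *m Z by exact: mulmxBl.
have -> : X *m lie Y Z = X *m (Y *m Z) - X *m (Z *m Y) by exact: mulmxBr.
apply: etrans (linearB _ _ _) (etrans _ (esym (linearB _ _ _))).
congr (_ - _); first by rewrite mulmxA.
by rewrite -mulmxA; apply: etrans (mxtrace_mulC _ _) _; rewrite mulmxA.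
Qed.

Local Opaque Defs.lie.

(** Positivity: since X is skew-Hermitian, X j k * X k j is minus the squared
    modulus of X j k. *)
Lemma kform_sum X : X \in su ->
  kform X X = 2 * n%:R * \sum_jk (complex.Re (X jk.1 jk.2) ^+ 2 + complex.Im (X jk.1 jk.2) ^+ 2).
Proof.
rewrite memv_su => /andP[/eqP XT _]; rewrite /kform /Rtr -mulrN; congr (_ * _).
rewrite sum_pair Re_sum -sumrN; apply: eq_bigr => j _; rewrite mxE Re_sum -sumrN.
apply: eq_bigr => k _ /=.
have : X k j = - (X j k)^*%C.
  have := congr1 (fun A : M => A k j) XT; rewrite !mxE => ->.
  by rewrite opprK.
by move=> ->; case: (X j k) => a b /=; ring.
Qed.

Lemma kform_ge0 X : (0 < n)%N -> X \in su -> 0 <= kform X X.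
Proof.
move=> n0 Xsu; rewrite kform_sum // !mulr_ge0 // sumr_ge0 // => jk _.
by rewrite addr_ge0 // sqr_ge0.
Qed.

Lemma kform_eq0 X : (0 < n)%N -> X \in su -> kform X X = 0 -> X = 0.
Proof.
move=> n0 Xsu /eqP; rewrite kform_sum // !mulf_eq0 !pnatr_eq0 /= gtn_eqF //=.
rewrite psumr_eq0 => [/allP X0|jk _]; last by rewrite addr_ge0 // sqr_ge0.
apply/matrixP => j k; have := X0 (j, k) (mem_index_enum _); rewrite /= mxE.
rewrite paddr_eq0 ?sqr_ge0 // !sqrf_eq0 => /andP[].
by case: (X j k) => a b /= /eqP -> /eqP ->.
Qed.

Local Transparent so_frame sq_frame.
Lemma graded_neq0 o : (1 < n)%N -> exists2 X, X \in graded o & X != 0.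
Proof.
move=> n1; pose a := Ordinal (ltnW n1); pose b := Ordinal n1.
case: o.
  exists (sq_frame (a, b)); first exact/sq_frame_in/ltnW.
  apply/eqP => /(congr1 (fun A : M => complex.Im (A a b))).
  rewrite /sq_frame cmat_scalecE Im_imul !mxE /= addr0 subr0.
  by move/eqP; rewrite oner_eq0.
exists (so_frame (a, b)); first exact: so_frame_in.
apply/eqP => /(congr1 (fun A : M => A a b)); rewrite !mxE !eqxx /= subr0.
by move/eqP; rewrite oner_eq0.
Qed.
Local Opaque so_frame sq_frame.

(** For y, z of parity o', the trace of ad y ad z on the part of parity o is
    minus this constant times the negative Killing form.  The two values for
    even y, z come from the Killing form of so, which is n - 2 times the trace
    form against 2n for su; for odd y, z the maps ad y and ad z exchange the two
    parts, so both contribute one half. *)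
Definition casimir_const (o o' : bool) : R :=
  if o' then 2^-1 else if o then (n%:R + 2) / (2 * n%:R) else (n%:R - 2) / (2 * n%:R).

Lemma vtrace_graded o o' A B : (0 < n)%N -> A \in graded o' -> B \in graded o' ->
  vtrace (graded o) (fun X => lie A (lie B X)) = - (casimir_const o o' * kform A B).
Proof.
move=> n0 Ao Bo; have nR : n%:R != 0 :> R by rewrite pnatr_eq0 -lt0n.
have A0 := graded_tr0 Ao.
have stable : {in graded o, forall X, lie A (lie B X) \in graded o}.
  move=> X Xo; have := lie_graded Ao (lie_graded Bo Xo).
  by rewrite addbA addbb.
have BT : complex.Re (\tr (A *m B^T)) = (-1) ^+ (~~ o') * Rtr A B.
  move: (Bo); rewrite gradedP => /and3P[/eqP -> _ _]; rewrite -scalemxAr mxtraceZ /Rtr.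
  by case: (o'); rewrite ?(expr0, expr1) ?mul1r ?mulN1r ?ReN.
rewrite /casimir_const /kform; case: o stable => stable.
  rewrite vtrace_sq // BT; case: (o'); rewrite ?(expr0, expr1) /=; field => //.
rewrite vtrace_so // BT; case: (o'); rewrite ?(expr0, expr1) /=; field => //.
Qed.

End SpecialUnitary.

(** * Curvature of diagonal metrics in a graded chart *)
Section LinearMaps.
Variables (F : fieldType) (V W : lmodType F) (f : V -> W).
Hypothesis f_lin : linear f.

Let lf : {linear V -> W} := HB.pack f (GRing.isLinear.Build F V W *:%R f f_lin).

Lemma lin0 : f 0 = 0. Proof. exact: (linear0 lf). Qed.
Lemma linN x : f (- x) = - f x. Proof. exact: (linearN lf). Qed.
Lemma linZ a x : f (a *: x) = a *: f x. Proof. exact: (linearZZ lf). Qed.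
Lemma lin_sum (I : finType) (x : I -> V) : f (\sum_i x i) = \sum_i f (x i).
Proof. exact: (linear_sum lf). Qed.

End LinearMaps.

(** The setting isolates what makes the Ricci curvature of a diagonal metric
    computable.  The tangent space p is a direct sum of copies emb a of the even
    or odd part (of parity par a) of a Lie algebra V graded by bool; the bracket
    of the copies a and b has component t a b c times the bracket of V in the
    copy c; its isotropy component acts on every copy by a multiple nu a of the
    bracket of V, and vanishes unless a = b; the metric is gam a times the form
    kf on the copy a. *)
Section GradedChart.
Variables (R : realType) (V W : vectType R) (I : finType).
Variables (U : bool -> {vspace V}) (lie : V -> V -> V) (kf : V -> V -> R).
Variables (par : I -> bool) (br : W -> W -> W) (k p : {vspace W}) (g : W -> W -> R).
Variables (emb : I -> {linear V -> W}) (co : I -> {linear W -> V}).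
Variables (t : I -> I -> I -> R) (nu gam : I -> R) (theta : bool -> bool -> R).

Hypothesis lieC : forall x y, lie x y = - lie y x.
Hypothesis lie_lin : forall x, linear (lie x).
Hypothesis jacobi : forall x y z, lie (lie x y) z = lie x (lie y z) - lie y (lie x z).
Hypothesis lieU : forall o o' x y, x \in U o -> y \in U o' -> lie x y \in U (o (+) o').
Hypothesis kfC : forall x y, kf x y = kf y x.
Hypothesis kf_lin : forall y, linear_for *%R (kf^~ y).
Hypothesis kf_lie : forall x y z, kf (lie x y) z = kf x (lie y z).
Hypothesis kf_ge0 : forall o x, x \in U o -> 0 <= kf x x.
Hypothesis kf_eq0 : forall o x, x \in U o -> kf x x = 0 -> x = 0.
Hypothesis U_neq0 : forall o, exists2 x, x \in U o & x != 0.
Hypothesis trace_lie_lie : forall o o' y z, y \in U o' -> z \in U o' ->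
  vtrace (U o) (fun x => lie y (lie z x)) = - (theta o o' * kf y z).

Local Notation Ui a := (U (par a)).
Hypothesis br_linl : forall Y, linear (br^~ Y).
Hypothesis br_linr : forall X, linear (br X).
Hypothesis emb_p : forall a x, x \in Ui a -> emb a x \in p.
Hypothesis co_U : forall a X, X \in p -> co a X \in Ui a.
Hypothesis emb_co : forall X, X \in p -> X = \sum_a emb a (co a X).
Hypothesis co_emb : forall a b x, x \in Ui b -> co a (emb b x) = (a == b)%:R *: x.
Hypothesis t_par : forall a b c, t a b c != 0 -> par c = par a (+) par b.
Hypothesis br_p : forall a b x y, x \in Ui a -> y \in Ui b ->
  prp k p (br (emb a x) (emb b y)) = \sum_e t a b e *: emb e (lie x y).
Hypothesis br_k : forall a b c x y z, x \in Ui a -> y \in Ui b -> z \in Ui c ->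
  br (prk k p (br (emb a x) (emb b y))) (emb c z)
    = ((a == b)%:R * nu a) *: emb c (lie (lie x y) z).
Hypothesis br_kp : forall X Z, X \in k -> Z \in p -> br X Z \in p.
Hypothesis g_co : {in p &, forall X Y, g X Y = \sum_a gam a * kf (co a X) (co a Y)}.
Hypothesis gam_gt0 : forall a, 0 < gam a.

Lemma lie_linl y : linear (lie^~ y).
Proof. by move=> a x x'; rewrite !(lieC _ y) lie_lin opprD scalerN. Qed.

(** Solving the Koszul formula: by invariance of kf its three terms are multiples
    of kf (lie x y) z, so the Levi-Civita connection has the same shape as the
    bracket, with these coefficients in place of t. *)
Definition lc_coef a b c : R :=
  (t a b c * gam c + t c a b * gam b - t c b a * gam a) / (2 * gam c).

Definition lc_conn (X Y : W) : W :=
  \sum_a \sum_b \sum_c lc_coef a b c *: emb c (lie (co a X) (co b Y)).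

Lemma lc_conn_linl Y : linear (lc_conn^~ Y).
Proof.
move=> s X X'; rewrite /lc_conn scaler_sumr -big_split; apply: eq_bigr => a _ /=.
rewrite scaler_sumr -big_split; apply: eq_bigr => b _ /=.
rewrite scaler_sumr -big_split; apply: eq_bigr => c _ /=.
by rewrite linearP lie_linl linearP scalerDr !scalerA mulrC.
Qed.

Lemma lc_conn_linr X : linear (lc_conn X).
Proof.
move=> s Y Y'; rewrite /lc_conn scaler_sumr -big_split; apply: eq_bigr => a _ /=.
rewrite scaler_sumr -big_split; apply: eq_bigr => b _ /=.
rewrite scaler_sumr -big_split; apply: eq_bigr => c _ /=.
by rewrite linearP lie_lin linearP scalerDr !scalerA mulrC.
Qed.

Lemma sub_lin (T : lmodType R) (s : R) (A A' B B' : T) :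
  (s *: A + A') - (s *: B + B') = s *: (A - B) + (A' - B').
Proof. by rewrite opprD addrACA -scalerBr. Qed.

Lemma prp_lin : linear (prp k p). Proof. by move=> s X Y; rewrite /prp linearP. Qed.

Lemma prk_lin : linear (prk k p). Proof. by move=> s X Y; rewrite /prk linearP. Qed.

Local Notation Riem := (curvature br k p lc_conn).

Lemma Riem_lin1 Y Z : linear (fun X => Riem X Y Z).
Proof.
move=> s X X'; rewrite /curvature lc_conn_linl (lc_conn_linl Z) lc_conn_linr br_linl.
by rewrite !(prp_lin, prk_lin) lc_conn_linl br_linl !sub_lin.
Qed.

Lemma Riem_lin2 X Z : linear (fun Y => Riem X Y Z).
Proof.
move=> s Y Y'; rewrite /curvature lc_conn_linl lc_conn_linr lc_conn_linl br_linr.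
by rewrite !(prp_lin, prk_lin) lc_conn_linl br_linl !sub_lin.
Qed.

Lemma Riem_lin3 X Y : linear (Riem X Y).
Proof.
move=> s Z Z'; rewrite /curvature !(lc_conn_linr, br_linr).
by rewrite !sub_lin.
Qed.

Lemma lc_coef_par a b c : lc_coef a b c != 0 -> par c = par a (+) par b.
Proof.
apply: contraNeq => par_c; rewrite /lc_coef.
have [-> -> ->] : [/\ t a b c = 0, t c a b = 0 & t c b a = 0].
  split; apply/eqP; apply: contraNT par_c => /t_par ->; first by [].
    by rewrite addbC addbK.
  by rewrite addbK.
by rewrite !mul0r addr0 subr0 mul0r.
Qed.

Lemma lc_conn_emb a b x y : x \in Ui a -> y \in Ui b ->
  lc_conn (emb a x) (emb b y) = \sum_c lc_coef a b c *: emb c (lie x y).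
Proof.
move=> xa yb; rewrite /lc_conn (bigD1 a) //= [X in _ + X]big1 ?addr0 => [|a' a'a].
  rewrite (bigD1 b) //= [X in _ + X]big1 ?addr0 => [|b' b'b].
    by apply: eq_bigr => c _; rewrite !co_emb // !eqxx !scale1r.
  by apply: big1 => c _; rewrite (co_emb _ yb) (negPf b'b) scale0r (lin0 (lie_lin _)) linear0 scaler0.
apply: big1 => b' _; apply: big1 => c _.
by rewrite (co_emb _ xa) (negPf a'a) scale0r (lin0 (lie_linl _)) linear0 scaler0.
Qed.

Lemma lie_Ui a b c x y : par c = par a (+) par b -> x \in Ui a -> y \in Ui b -> lie x y \in Ui c.
Proof. by move=> -> xa yb; apply: lieU. Qed.

(** A structure coefficient vanishes unless the parities match, hence membership
    of a bracket in the right part of V is only known when the coefficient in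
    front of it is nonzero.  The following lemmas carry that coefficient. *)
Lemma co_emb_scaled a f s v : (s != 0 -> v \in Ui f) ->
  s *: co a (emb f v) = ((a == f)%:R * s) *: v.
Proof.
have [->|s0 vf] := eqVneq s 0; first by rewrite mulr0 !scale0r.
by rewrite co_emb ?vf // scalerA mulrC.
Qed.

Lemma lc_conn_emb_scaled a e s x w : x \in Ui a -> (s != 0 -> w \in Ui e) ->
  s *: lc_conn (emb a x) (emb e w) = \sum_f (s * lc_coef a e f) *: emb f (lie x w).
Proof.
move=> xa; have [->|s0 we] := eqVneq s 0.
  by rewrite scale0r big1 // => f _; rewrite mul0r scale0r.
by rewrite lc_conn_emb ?we // scaler_sumr; apply: eq_bigr => f _; rewrite scalerA.
Qed.

Lemma lc_conn_emb_scaledl e c s w z : (s != 0 -> w \in Ui e) -> z \in Ui c ->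
  s *: lc_conn (emb e w) (emb c z) = \sum_f (s * lc_coef e c f) *: emb f (lie w z).
Proof.
move=> we zc; have [->|s0] := eqVneq s 0.
  by rewrite scale0r big1 // => f _; rewrite mul0r scale0r.
by rewrite lc_conn_emb ?we // scaler_sumr; apply: eq_bigr => f _; rewrite scalerA.
Qed.

Lemma co_lc_conn_lc_conn a b c f x y z : x \in Ui a -> y \in Ui b -> z \in Ui c ->
  co f (lc_conn (emb a x) (lc_conn (emb b y) (emb c z)))
    = (\sum_e lc_coef b c e * lc_coef a e f) *: lie x (lie y z).
Proof.
move=> xa yb zc; rewrite (lc_conn_emb yb zc) (lin_sum (lc_conn_linr _)) linear_sum scaler_suml.
apply: eq_bigr => e _; rewrite (linZ (lc_conn_linr _)).
rewrite lc_conn_emb_scaled //; last by move=> /lc_coef_par /lie_Ui; exact.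
rewrite linear_sum (bigD1 f) //= [X in _ + X]big1 ?addr0 => [|h hf].
  rewrite linearZZ co_emb_scaled ?eqxx ?mul1r //.
  rewrite mulf_eq0 negb_or => /andP[/lc_coef_par bce /lc_coef_par aef].
  exact: lie_Ui aef xa (lie_Ui bce yb zc).
rewrite linearZZ co_emb_scaled; first by rewrite eq_sym (negPf hf) mul0r scale0r.
rewrite mulf_eq0 negb_or => /andP[/lc_coef_par bce /lc_coef_par aef].
exact: lie_Ui aef xa (lie_Ui bce yb zc).
Qed.

Lemma co_lc_conn_prp a b c f x y z : x \in Ui a -> y \in Ui b -> z \in Ui c ->
  co f (lc_conn (prp k p (br (emb a x) (emb b y))) (emb c z))
    = (\sum_e t a b e * lc_coef e c f) *: lie (lie x y) z.
Proof.
move=> xa yb zc; rewrite (br_p xa yb) (lin_sum (lc_conn_linl _)) linear_sum scaler_suml.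
apply: eq_bigr => e _; rewrite (linZ (lc_conn_linl _)).
rewrite lc_conn_emb_scaledl //; last by move=> /t_par /lie_Ui; exact.
rewrite linear_sum (bigD1 f) //= [X in _ + X]big1 ?addr0 => [|h hf].
  rewrite linearZZ co_emb_scaled ?eqxx ?mul1r //.
  rewrite mulf_eq0 negb_or => /andP[/t_par bce /lc_coef_par aef].
  exact: lie_Ui aef (lie_Ui bce xa yb) zc.
rewrite linearZZ co_emb_scaled; first by rewrite eq_sym (negPf hf) mul0r scale0r.
rewrite mulf_eq0 negb_or => /andP[/t_par bce /lc_coef_par aef].
exact: lie_Ui aef (lie_Ui bce xa yb) zc.
Qed.

(** Coefficient of kf (y, z) in the trace over the copy a of the curvature of
    emb b y, emb c z, up to the constant theta: each term of the curvature sends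
    the copy a to itself by a product of two structure coefficients followed by
    a double bracket. *)
Definition ric_coef a b c : R :=
  \sum_e (t a b e * lc_coef e c a - lc_coef a c e * lc_coef b e a)
  + (a == b)%:R * nu a * (a == c)%:R.

(** The Ricci curvature of emb b y and emb c z is rho b c * kf y z. *)
Definition rho b c : R := \sum_a theta (par a) (par b) * ric_coef a b c.

(** By antisymmetry and the Jacobi identity the double brackets in the curvature
    are combinations of lie y (lie z x) and lie z (lie y x), which have the same
    trace.  The contributions of the term in which x acts last, of coefficient A
    below, cancel: it is the trace of ad (lie y z). *)
Lemma trace_Riem a b c y z : y \in Ui b -> z \in Ui c ->
  vtrace (Ui a) (fun x => co a (Riem (emb a x) (emb b y) (emb c z)))
    = theta (par a) (par b) * ric_coef a b c * kf y z.
Proof.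
move=> yb zc.
set A := \sum_e lc_coef b c e * lc_coef a e a; set B := \sum_e lc_coef a c e * lc_coef b e a.
set C := \sum_e t a b e * lc_coef e c a; set D := (a == b)%:R * nu a * (a == c)%:R.
have ricE : ric_coef a b c = C - B + D by rewrite /ric_coef sumrB.
transitivity (vtrace (Ui a) (fun x => A *: (lie z (lie y x) + -1 *: lie y (lie z x))
    + (- B) *: (-1 *: lie y (lie z x)) + (- C) *: lie z (lie y x)
    + (- D) *: lie z (lie y x))).
  apply: eq_in_vtrace => x xa; rewrite /curvature !linearB /=.
  rewrite !co_lc_conn_lc_conn // co_lc_conn_prp // br_k // (linearZZ (co a)) co_emb_scaled; last first.
    rewrite mulf_eq0 negb_or pnatr_eq0 eqb0 negbK => /andP[/eqP ab _].
    by have := lieU (lieU xa yb) zc; rewrite ab addbb.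
  rewrite [(a == c)%:R * _]mulrC -/A -/B -/C -/D.
  have -> : lie (lie x y) z = lie z (lie y x).
    by rewrite lieC [lie x y]lieC (linN (lie_lin _)) opprK.
  have -> : lie y (lie x z) = - lie y (lie z x).
    by rewrite [lie x z]lieC (linN (lie_lin _)).
  have -> : lie x (lie y z) = lie z (lie y x) - lie y (lie z x).
    by rewrite lieC jacobi opprB.
  by rewrite !scaleN1r !scaleNr.
rewrite !(vtraceD, vtraceZ) ricE; have [bc|bc] := eqVneq (par b) (par c).
  have zb : z \in Ui b by rewrite bc.
  by rewrite (trace_lie_lie _ yb zb) (trace_lie_lie _ zb yb) (kfC z); ring.
have [A0 B0 C0 D0] : [/\ A = 0, B = 0, C = 0 & D = 0].
  (* If y and z have different parities, every coefficient has a vanishing factor. *)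
  have par0 s s' : (s != 0 -> s' != 0 -> par b = par c) -> s * s' = 0.
    move=> ss'; have [->|s0] := eqVneq s 0; first by rewrite mul0r.
    have [->|s'0] := eqVneq s' 0; first by rewrite mulr0.
    by rewrite ss' ?eqxx in bc.
  split.
  - apply: big1 => e _; apply: par0 => /lc_coef_par be /lc_coef_par; rewrite be; by case: (par a) (par b) (par c) => [] [] [].
  - apply: big1 => e _; apply: par0 => /lc_coef_par be /lc_coef_par; rewrite be; by case: (par a) (par b) (par c) => [] [] [].
  - apply: big1 => e _; apply: par0 => /t_par be /lc_coef_par; rewrite be; by case: (par a) (par b) (par c) => [] [] [].
  - rewrite /D; have [ab|] := eqVneq a b; last by rewrite !mul0r.
    have [ac|] := eqVneq a c; last by rewrite mulr0.
    by move: bc; rewrite -ab -ac eqxx.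
by rewrite A0 B0 C0 D0; ring.
Qed.

(** The bases of the copies, read through co, form a frame of p. *)
Lemma chart_frame f : linear f -> {in p, forall X, f X \in p} ->
  vtrace p f = \sum_a vtrace (Ui a) (fun x => co a (f (emb a x))).
Proof.
move=> f_lin fp.
pose J := {a : I & 'I_(\dim (Ui a))}.
pose e (j : J) := emb (tag j) (vbasis (Ui (tag j)))`_(tagged j).
pose l (j : J) X := coord (vbasis (Ui (tag j))) (tagged j) (co (tag j) X).
have bU (j : J) : (vbasis (Ui (tag j)))`_(tagged j) \in Ui (tag j).
  by rewrite vbasis_mem // mem_nth ?size_tuple.
rewrite (@vtrace_frame _ _ _ _ e l f) //.
- by rewrite (sig_big_dep (fun _ => true) (fun _ _ => true)
    (fun a (i : 'I_(\dim (Ui a))) => coord (vbasis (Ui a)) i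
       (co a (f (emb a (vbasis (Ui a))`_i))))).
- by move=> j; apply/emb_p/bU.
- by move=> j s X Y; rewrite /l !linearP.
move=> X Xp; rewrite {1}(emb_co Xp).
rewrite -(sig_big_dep (fun _ => true) (fun _ _ => true)
    (fun a (i : 'I_(\dim (Ui a))) => coord (vbasis (Ui a)) i (co a X) *:
        emb a (vbasis (Ui a))`_i)).
apply: eq_bigr => a _; rewrite {1}(coord_vbasis (co_U a Xp)) linear_sum.
by apply: eq_bigr => i _; rewrite linearZZ.
Qed.

Lemma prp_in X : prp k p X \in p.
Proof. exact: memv_pi. Qed.

Lemma emb_scaled_in c s v : (s != 0 -> v \in Ui c) -> s *: emb c v \in p.
Proof.
have [->|s0 vc] := eqVneq s 0; first by rewrite scale0r mem0v.
by rewrite rpredZ // emb_p // vc.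
Qed.

Lemma lc_conn_in X Y : X \in p -> Y \in p -> lc_conn X Y \in p.
Proof.
move=> Xp Yp; apply: rpred_sum => a _; apply: rpred_sum => b _.
apply: rpred_sum => c _; apply: emb_scaled_in => /lc_coef_par /lie_Ui.
by apply; apply: co_U.
Qed.

Lemma Riem_in X Y Z : X \in p -> Y \in p -> Z \in p -> Riem X Y Z \in p.
Proof.
move=> Xp Yp Zp; rewrite /curvature !rpredB ?lc_conn_in ?prp_in //.
by apply: br_kp => //; apply: memv_pi.
Qed.

Let kfl y : {scalar V} :=
  HB.pack (kf^~ y) (GRing.isLinear.Build R V R *%R (kf^~ y) (kf_lin y)).

Lemma kf_suml (J : finType) (x : J -> V) y : kf (\sum_j x j) y = \sum_j kf (x j) y.
Proof. exact: (linear_sum (kfl y)). Qed.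

Lemma kfZl s x y : kf (s *: x) y = s * kf x y.
Proof. by have := kf_lin y s x 0; rewrite addr0 [kf 0 y](linear0 (kfl y)) addr0. Qed.

Lemma kfNl x y : kf (- x) y = - kf x y.
Proof. exact: (linearN (kfl y)). Qed.

Lemma kfBl x x' y : kf (x - x') y = kf x y - kf x' y.
Proof. by rewrite addrC -scaleN1r kf_lin mulN1r addrC. Qed.

Lemma co_lc_conn c X Y : X \in p -> Y \in p ->
  co c (lc_conn X Y) = \sum_a \sum_b lc_coef a b c *: lie (co a X) (co b Y).
Proof.
move=> Xp Yp; rewrite linear_sum; apply: eq_bigr => a _.
rewrite linear_sum; apply: eq_bigr => b _.
rewrite linear_sum (bigD1 c) //= [X in _ + X]big1 ?addr0 => [|d dc].
  rewrite (linearZZ (co c)) co_emb_scaled ?eqxx ?mul1r // => /lc_coef_par /lie_Ui.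
  by apply; apply: co_U.
rewrite (linearZZ (co c)) co_emb_scaled => [|/lc_coef_par /lie_Ui]; last by apply; apply: co_U.
by rewrite eq_sym (negPf dc) mul0r scale0r.
Qed.

Lemma co_br c X Y : X \in p -> Y \in p ->
  co c (prp k p (br X Y)) = \sum_a \sum_b t a b c *: lie (co a X) (co b Y).
Proof.
move=> Xp Yp; rewrite {1}(emb_co Xp) (lin_sum (br_linl _)) (lin_sum prp_lin).
rewrite linear_sum; apply: eq_bigr => a _.
rewrite {1}(emb_co Yp) (lin_sum (br_linr _)) (lin_sum prp_lin).
rewrite linear_sum; apply: eq_bigr => b _.
rewrite br_p ?co_U // linear_sum (bigD1 c) //= [X in _ + X]big1 ?addr0 => [|d dc].
  rewrite (linearZZ (co c)) co_emb_scaled ?eqxx ?mul1r // => /t_par /lie_Ui.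
  by apply; apply: co_U.
rewrite (linearZZ (co c)) co_emb_scaled => [|/t_par /lie_Ui]; last by apply; apply: co_U.
by rewrite eq_sym (negPf dc) mul0r scale0r.
Qed.

Lemma kf_lie_perm x y z : kf (lie z x) y = kf (lie x y) z.
Proof. by rewrite kf_lie kfC. Qed.

Lemma triple_sum s X Y Z :
  \sum_c gam c * kf (\sum_a \sum_b s a b c *: lie (co a X) (co b Y)) (co c Z)
   = \sum_a \sum_b \sum_c s a b c * gam c * kf (lie (co a X) (co b Y)) (co c Z).
Proof.
under eq_bigr => c _ do rewrite kf_suml mulr_sumr.
rewrite exchange_big; apply: eq_bigr => a _ /=.
under eq_bigr => c _ do rewrite kf_suml mulr_sumr.
rewrite exchange_big; apply: eq_bigr => b _ /=.
by apply: eq_bigr => c _; rewrite kfZl mulrA [gam c * _]mulrC.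
Qed.

Lemma lc_conn_levi_civita : is_levi_civita br k p g lc_conn.
Proof.
split=> [X Y Xp Yp|X Y Z Xp Yp Zp]; first exact: lc_conn_in.
rewrite !g_co ?prp_in ?lc_conn_in //.
under eq_bigr => c _ do rewrite co_lc_conn //.
under [X in _ = X + _ + _]eq_bigr => c _ do rewrite co_br //.
under [X in _ = _ + X + _]eq_bigr => c _ do rewrite co_br //.
under [X in _ = _ + X]eq_bigr => c _ do rewrite co_br // kfC.
rewrite !triple_sum [X in _ = _ + X + _]exchange_big.
rewrite [X in _ = _ + X]exchange_big; under [X in _ = _ + X]eq_bigr do rewrite exchange_big.
rewrite [X in _ = _ + X]exchange_big; under [X in _ = _ + X + _]eq_bigr do rewrite exchange_big.
rewrite /= mulr_sumr -!big_split; apply: eq_bigr => a _ /=.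
rewrite mulr_sumr -!big_split; apply: eq_bigr => b _ /=.
rewrite mulr_sumr -!big_split; apply: eq_bigr => c _ /=.
rewrite [kf (lie (co c Z) (co b Y)) _]kf_lie_perm [lie (co b Y) (co a X)]lieC kfNl.
rewrite [kf (lie (co c Z) (co a X)) _]kf_lie_perm /lc_coef; field.
by rewrite gt_eqF.
Qed.

(** Two solutions of the Koszul formula differ by a vector D with g D D = 0. *)
Lemma levi_civita_unique L : is_levi_civita br k p g L ->
  {in p &, forall X Y, L X Y = lc_conn X Y}.
Proof.
move=> [L_p L_koszul] X Y Xp Yp; apply/eqP; rewrite -subr_eq0; apply/eqP.
have [lc_conn_p lc_conn_koszul] := lc_conn_levi_civita.
set D := _ - _; have Dp : D \in p by rewrite rpredB ?L_p ?lc_conn_p.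
have gD : \sum_a gam a * kf (co a D) (co a D) = 0.
  have : 2 * g (L X Y) D = 2 * g (lc_conn X Y) D by rewrite L_koszul // lc_conn_koszul.
  move/(mulfI _); rewrite pnatr_eq0 => /(_ isT).
  rewrite !g_co ?L_p ?lc_conn_p // => /eqP; rewrite -subr_eq0 -sumrB => /eqP diff0; rewrite -[RHS]diff0.
  by apply: eq_bigr => a _; rewrite {1}/D linearB kfBl mulrBr.
have coD a : co a D = 0.
  have /eqP := gD; rewrite psumr_eq0 => [/allP /(_ a (mem_index_enum _))|b _].
    rewrite mulf_eq0 gt_eqF //= => /eqP; exact: kf_eq0 (co_U a Dp).
  by rewrite mulr_ge0 ?(ltW (gam_gt0 b)) //; apply: kf_ge0 (co_U b Dp).
by rewrite (emb_co Dp) big1 // => a _; rewrite coD linear0.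
Qed.

Lemma ricci_lc_conn Y Z : Y \in p -> Z \in p ->
  ricci br k p lc_conn Y Z = \sum_b \sum_c rho b c * kf (co b Y) (co c Z).
Proof.
move=> Yp Zp; rewrite /ricci chart_frame; first 1 last.
- exact: Riem_lin1.
- by move=> X Xp; apply: Riem_in.
under eq_bigr => a _.
  under eq_in_vtrace => x _.
    rewrite {1}(emb_co Yp) (lin_sum (Riem_lin2 _ _)) linear_sum.
    under eq_bigr => b _.
      rewrite {1}(emb_co Zp) (lin_sum (Riem_lin3 _ _)) linear_sum.
      over.
    over.
  rewrite vtrace_sum.
  under eq_bigr => b _.
    rewrite vtrace_sum.
    under eq_bigr => c _ do rewrite trace_Riem ?co_U //.
    over.
  over.
rewrite exchange_big; apply: eq_bigr => b _ /=.
rewrite exchange_big; apply: eq_bigr => c _ /=.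
by rewrite /rho mulr_suml.
Qed.

(** Any Levi-Civita connection agrees with lc_conn on p, so the Einstein equation is
    about rho alone; testing it on one nonzero vector of each copy recovers the
    equations on the diagonal of rho. *)
Lemma einstein_chart : (forall b c, b != c -> rho b c = 0) ->
  einstein br k p g <-> exists lam, forall b, rho b b = lam * gam b.
Proof.
move=> rho0.
have ricciE L : is_levi_civita br k p g L -> {in p &, forall Y Z,
    ricci br k p L Y Z = \sum_b rho b b * kf (co b Y) (co b Z)}.
  move=> L_lc Y Z Yp Zp; have LE := levi_civita_unique L_lc.
  transitivity (ricci br k p lc_conn Y Z).
    apply: eq_in_vtrace => X Xp; rewrite /curvature.
    by rewrite !LE ?prp_in ?lc_conn_in.
  rewrite ricci_lc_conn //; apply: eq_bigr => b _.
  rewrite (bigD1 b) //= [X in _ + X]big1 ?addr0 // => c cb.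
  by rewrite rho0 ?mul0r // eq_sym.
split=> [[L [L_lc [lam ric_lam]]]|[lam rho_lam]].
  exists lam => b; have [x xb x0] := U_neq0 (par b).
  have xp := emb_p xb.
  have := ric_lam _ _ xp xp; rewrite (ricciE L) // g_co //.
  rewrite (bigD1 b) //= [X in _ + X]big1 => [|c cb]; last first.
    by rewrite co_emb // (negPf cb) scale0r -(scale0r 0) kfZl mul0r mulr0.
  rewrite addr0 [X in lam * X](bigD1 b) //= [X in lam * (_ + X)]big1 => [|c cb]; last first.
    by rewrite co_emb // (negPf cb) scale0r -(scale0r 0) kfZl mul0r mulr0.
  rewrite addr0 mulrA co_emb // eqxx scale1r; apply: mulIf.
  by apply: contra_neq x0; apply: kf_eq0 xb.
exists lc_conn; split; first exact: lc_conn_levi_civita.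
exists lam => Y Z Yp Zp; rewrite (ricciE lc_conn) ?g_co //; last exact: lc_conn_levi_civita.
by rewrite mulr_sumr; apply: eq_bigr => b _; rewrite rho_lam mulrA.
Qed.

End GradedChart.

(** * The chart of SU(n)^3 / SO(n) *)
Section Chart.
Variables (R : realType) (n : nat).
Local Opaque Defs.lie gproj kform Defs.Q.
Local Notation cmat := (cmat R n).
Local Notation cmat3 := {ffun 'I_3 -> cmat}.
Local Notation su := (su R n).
Local Notation lie := (@lie R n).
Local Notation lie3 := (@lie3 R n).
Local Notation Q := (@Q R n).
Local Notation graded := (graded R n).
Local Notation gproj := (@gproj R n).
Local Notation kform := (@kform R n).
Local Notation tens := (@tens R n).

Definition is_odd (a : 'I_5) : bool := (a < 3)%N.

(** Every summand of the tangent space is tens (weight a) of so or sq.  The last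
    two weights are multiples of v1 and v2: rescaling does not change the summand
    and keeps all structure constants rational. *)
Definition weight (a : 'I_5) (j : 'I_3) : R :=
  nth 0 (nth [::] [:: [:: 1; 0; 0]; [:: 0; 1; 0]; [:: 0; 0; 1]; [:: 1; -1; 0]; [:: 1; 1; -2]] a) j.

Definition weight_norm (a : 'I_5) : R := [:: 1; 1; 1; 2; 6]`_a.

Local Notation grade a := (graded (is_odd a)).

Lemma weight_norm_gt0 a : 0 < weight_norm a.
Proof. by case: a => [[|[|[|[|[|//]]]]] ?] /=; rewrite /weight_norm /= ?ltr01 ?ltr0n. Qed.

Lemma sum3 (F : 'I_3 -> R) : \sum_j F j = F 0 + F 1 + F 2.
Proof.
rewrite 3!big_ord_recl big_ord0 addr0 addrA; congr (_ + F _ + F _); exact: val_inj.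
Qed.

Lemma weight_orth a b : is_odd a = is_odd b ->
  \sum_j weight a j * weight b j = (a == b)%:R * weight_norm a.
Proof.
rewrite sum3.
by case: a b => [[|[|[|[|[|//]]]]] ?] [[|[|[|[|[|//]]]]] ?] //= _;
  rewrite /weight /weight_norm /=; ring.
Qed.

Lemma weight_sum a : ~~ is_odd a -> \sum_j weight a j = 0.
Proof.
by rewrite sum3; case: a => [[|[|[|[|[|//]]]]] ?] //= _; rewrite /weight /=; ring.
Qed.

(** The weights of a given parity form an orthogonal basis of R^3, once the
    diagonal direction (1, 1, 1), of squared norm 3, is added in the even case. *)
Lemma weight_complete o j k :
  \sum_(a | is_odd a == o) weight a j * weight a k / weight_norm a
     + (~~ o)%:R / 3 = (j == k)%:R.
Proof.
rewrite big_mkcond 5!big_ord_recl big_ord0 /=.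
by case: o j k => [] [[|[|[|//]]] ?] [[|[|[|//]]] ?];
  rewrite /weight /weight_norm /is_odd /=; field.
Qed.

Lemma memv_tensv t (U : {vspace cmat}) X :
  reflect (exists2 x, x \in U & X = tens t x) (X \in tensv t U).
Proof.
by apply: (iffP memv_imgP) => -[x xU ->]; exists x; rewrite ?lfunE.
Qed.

Lemma tensvZ s t (U : {vspace cmat}) : s != 0 ->
  tensv (fun j => s * t j) U = tensv t U.
Proof.
move=> s0; apply/vspaceP => X; apply/memv_tensv/memv_tensv => -[x xU ->].
  exists (s *: x); first by rewrite rpredZ.
  by apply/ffunP => j; rewrite !ffunE scalerA mulrC.
exists (s^-1 *: x); first by rewrite rpredZ.
by apply/ffunP => j; rewrite !ffunE scalerA mulrAC divff // mul1r.
Qed.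

Lemma eq_tensv t t' (U : {vspace cmat}) : t =1 t' -> tensv t U = tensv t' U.
Proof.
move=> tt'; apply/vspaceP => X; apply/memv_tensv/memv_tensv => -[x xU ->];
  by exists x => //; apply/ffunP => j; rewrite !ffunE tt'.
Qed.

Lemma summandE a : summand R n a = tensv (weight a) (grade a).
Proof.
have neq0 m : (0 < m)%N -> (Num.sqrt (m%:R : R))^-1 != 0.
  by move=> m0; rewrite invr_eq0 gt_eqF // sqrtr_gt0 ltr0n.
case: a => [[|[|[|[|[|//]]]]] ?]; rewrite /summand /= /is_odd /graded /=.
- by apply: eq_tensv => -[[|[|[|//]]] ?]; rewrite /factor /weight -val_eqE /=.
- by apply: eq_tensv => -[[|[|[|//]]] ?]; rewrite /factor /weight -val_eqE /=.
- by apply: eq_tensv => -[[|[|[|//]]] ?]; rewrite /factor /weight -val_eqE /=.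
- by rewrite -[RHS](tensvZ _ _ (neq0 2%N isT)); apply: eq_tensv => j; rewrite /v1 /weight.
- by rewrite -[RHS](tensvZ _ _ (neq0 6%N isT)); apply: eq_tensv => j; rewrite /v2 /weight.
Qed.

Definition emb (a : 'I_5) : {linear cmat -> cmat3} := tens (weight a).

(** Pairing with a weight is orthogonal projection onto its line; copies of different
    parity are separated by gproj, not by the weights. *)
Definition coord3 (a : 'I_5) (X : cmat3) : cmat :=
  gproj (is_odd a) ((weight_norm a)^-1 *: \sum_j weight a j *: X j).

Lemma coord3_lin a : linear (coord3 a).
Proof.
move=> s X Y; rewrite /coord3 -linearP; congr (gproj _ _).
rewrite scalerA [s * _]mulrC -scalerA -scalerDr; congr (_ *: _).
rewrite scaler_sumr -big_split; apply: eq_bigr => j _ /=.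
by rewrite !ffunE scalerDr !scalerA [s * _]mulrC.
Qed.
HB.instance Definition _ a := GRing.isLinear.Build R cmat3 cmat _ (coord3 a)
  (coord3_lin a).

Lemma coord3_tens a t o x : x \in graded o ->
  coord3 a (tens t x)
    = ((is_odd a == o)%:R * ((\sum_j weight a j * t j) / weight_norm a)) *: x.
Proof.
move=> xo; rewrite /coord3.
have -> : \sum_j weight a j *: tens t x j = (\sum_j weight a j * t j) *: x.
  by rewrite scaler_suml; apply: eq_bigr => j _; rewrite ffunE scalerA.
by rewrite !linearZ_LR /= (gproj_graded _ xo) !scalerA; congr (_ *: _); ring.
Qed.

Lemma coord3_emb a b x : x \in grade b -> coord3 a (emb b x) = (a == b)%:R *: x.
Proof.
move=> xb; rewrite (coord3_tens _ _ xb); congr (_ *: _).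
have [ab|ab] := eqVneq (is_odd a) (is_odd b).
  by rewrite weight_orth // mul1r mulfK // gt_eqF // weight_norm_gt0.
by rewrite mul0r; have [ab'|//] := eqVneq a b; rewrite ab' eqxx in ab.
Qed.

Lemma emb_tangent a x : x \in grade a -> emb a x \in tangent R n.
Proof.
move=> xa; rewrite /tangent (bigD1 a) //= -[emb a x]addr0 memv_add ?mem0v //.
by rewrite summandE; apply/memv_tensv; exists x.
Qed.

Lemma embE a x j : emb a x j = weight a j *: x.
Proof. by rewrite ffunE. Qed.

Lemma tangentP X : X \in tangent R n ->
  exists2 x, (forall a, x a \in grade a) & X = \sum_a emb a (x a).
Proof.
move=> /memv_sumP[Xs Xs_in ->].
have xP a : exists x, (x \in grade a) && (Xs a == emb a x).
  have := Xs_in a isT; rewrite summandE => /memv_tensv[x xa ->].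
  by exists x; rewrite xa eqxx.
exists (fun a => xchoose (xP a)) => [a|].
  by have /andP[] := xchooseP (xP a).
by apply: eq_bigr => a _; have /andP[_ /eqP] := xchooseP (xP a).
Qed.

Lemma coord3_sum a x : (forall b, x b \in grade b) ->
  coord3 a (\sum_b emb b (x b)) = x a.
Proof.
move=> xU; rewrite linear_sum (bigD1 a) //= [X in _ + X]big1 ?addr0 => [|b ba].
  by rewrite coord3_emb // eqxx scale1r.
by rewrite coord3_emb // eq_sym (negPf ba) scale0r.
Qed.

Lemma coord3_in a X : X \in tangent R n -> coord3 a X \in grade a.
Proof. by move=> /tangentP[x xU ->]; rewrite coord3_sum. Qed.

Lemma emb_coord3 X : X \in tangent R n -> X = \sum_a emb a (coord3 a X).
Proof.
move=> /tangentP[x xU ->]; apply: eq_bigr => a _.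
by rewrite coord3_sum.
Qed.

Lemma tangent_delta : (tangent R n :&: delta_so R n = 0)%VS.
Proof.
apply/eqP; rewrite -subv0; apply/subvP => X; rewrite memv_cap memv0.
move=> /andP[Xp /memv_tensv[x xso Xx]]; apply/eqP; rewrite (emb_coord3 Xp) big1 // => a _.
have xg : x \in graded false by [].
rewrite {}Xx (coord3_tens _ _ xg) [_ == false]eqbF_neg.
have [a_odd|a_even] := boolP (is_odd a); first by rewrite mul0r scale0r linear0.
under eq_bigr do rewrite mulr1.
by rewrite weight_sum // mul0r mulr0 scale0r linear0.
Qed.

(** Completeness of the weights, applied to the even and to the odd parts of the
    three components of X. *)
Lemma su3_split (X : cmat3) : (forall j, X j \in su) ->
  X = \sum_a emb a (coord3 a X) + tens (fun=> 1) (gproj false (3^-1 *: \sum_j X j)).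
Proof.
move=> Xsu; apply/ffunP => j.
have ffunD (A B : cmat3) : (A + B) j = A j + B j by rewrite ffunE.
have tens1 x : tens (fun=> 1) x j = x by rewrite ffunE scale1r.
rewrite ffunD tens1 sum_ffunE.
pose mean o k := \sum_(a | is_odd a == o) weight a j * weight a k / weight_norm a
  + (~~ o)%:R / 3.
have mean_proj o : \sum_(a | is_odd a == o) emb a (coord3 a X) j
    + (~~ o)%:R *: gproj o (3^-1 *: \sum_k X k) = gproj o (X j).
  transitivity (\sum_k mean o k *: gproj o (X k)).
    transitivity (\sum_k (\sum_(a | is_odd a == o) (weight a j * weight a k / weight_norm a) *: gproj o (X k)
      + ((~~ o)%:R / 3) *: gproj o (X k))).
      rewrite big_split /= -scaler_sumr; congr (_ + _); last first.
        by rewrite (linearZ_LR (gproj o)) /= scalerA linear_sum.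
      rewrite exchange_big; apply: eq_bigr => a /eqP ao.
      rewrite ffunE /coord3 ao (linearZ_LR (gproj o)) /= scalerA linear_sum scaler_sumr.
      apply: eq_bigr => k _; rewrite (linearZ_LR (gproj o)) /= scalerA; congr (_ *: _); ring.
    by apply: eq_bigr => k _; rewrite -scaler_suml -scalerDl.
  rewrite (bigD1 j) //= [X in _ + X]big1 ?addr0 => [|k kj].
    by rewrite /mean weight_complete eqxx scale1r.
  by rewrite /mean weight_complete eq_sym (negPf kj) scale0r.
rewrite {1}(gproj_sum (X j)) -!mean_proj /= scale1r scale0r addr0 addrAC.
congr (_ + _); rewrite [RHS](bigID (fun a => is_odd a == false)) /=; congr (_ + _).
by apply: eq_bigl => a; case: is_odd.
Qed.

(** The splitting of su3_split is the one along tangent and delta_so, as these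
    intersect trivially. *)
Lemma prp_su3 (X : cmat3) : (forall j, X j \in su) ->
  prp (delta_so R n) (tangent R n) X = \sum_a emb a (coord3 a X) /\
  prk (delta_so R n) (tangent R n) X
    = tens (fun=> 1) (gproj false (3^-1 *: \sum_j X j)).
Proof.
move=> Xsu; set A := \sum_a _; set B := tens _ _.
have Ap : A \in tangent R n.
  apply: rpred_sum => a _; apply: emb_tangent; apply: gproj_in.
  by rewrite rpredZ // rpred_sum // => j _; rewrite rpredZ.
have Bk : B \in delta_so R n.
  apply/memv_tensv; exists (gproj false (3^-1 *: \sum_j X j)) => //.
  have : 3^-1 *: \sum_j X j \in su by rewrite rpredZ // rpred_sum.
  by move/(gproj_in false).
have kp0 : (delta_so R n :&: tangent R n = 0)%VS by rewrite capvC tangent_delta.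
have XAB : X = A + B by exact: su3_split.
have prp_B : daddv_pi (tangent R n) (delta_so R n) B = 0.
  have := daddv_pi_add tangent_delta (subvP (addvSr _ _) _ Bk).
  by rewrite (daddv_pi_id kp0 Bk) => /eqP; rewrite -subr_eq0 addrK => /eqP.
have prk_A : daddv_pi (delta_so R n) (tangent R n) A = 0.
  have := daddv_pi_add kp0 (subvP (addvSr _ _) _ Ap).
  by rewrite (daddv_pi_id tangent_delta Ap) => /eqP; rewrite -subr_eq0 addrK => /eqP.
rewrite /prp /prk XAB !linearD /= prp_B prk_A addr0 add0r.
by rewrite daddv_pi_id ?tangent_delta // daddv_pi_id.
Qed.

Lemma lie3_tens t t' x y :
  lie3 (tens t x) (tens t' y) = tens (fun j => t j * t' j) (lie x y).
Proof. by apply/ffunP => j; rewrite !ffunE lieZl lieZr scalerA. Qed.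

Lemma lie3_linl Y : linear (lie3^~ Y).
Proof. by move=> s X X'; apply/ffunP => j; rewrite !ffunE lieDl lieZl. Qed.

Lemma lie3_linr X : linear (lie3 X).
Proof. by move=> s Y Y'; apply/ffunP => j; rewrite !ffunE lieDr lieZr. Qed.

(** The components of the bracket of two copies are products of weights, so the structure
    constants are the coordinates of the pointwise product of two weights. *)
Definition str_const (a b c : 'I_5) : R :=
  (is_odd c == is_odd a (+) is_odd b)%:R *
  ((\sum_j weight c j * (weight a j * weight b j)) / weight_norm c).

Lemma str_const_par a b c : str_const a b c != 0 -> is_odd c = is_odd a (+) is_odd b.
Proof. by rewrite /str_const; case: (eqVneq (is_odd c)) => // _; rewrite mul0r eqxx. Qed.

Lemma tens_lie_su t a b x y : x \in grade a -> y \in grade b ->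
  forall j, tens t (lie x y) j \in su.
Proof.
by move=> xa yb j; rewrite ffunE rpredZ // (graded_su (lie_graded xa yb)).
Qed.

Lemma prp_lie3 a b x y : x \in grade a -> y \in grade b ->
  prp (delta_so R n) (tangent R n) (lie3 (emb a x) (emb b y))
    = \sum_e str_const a b e *: emb e (lie x y).
Proof.
move=> xa yb; have [+ _] := prp_su3 (tens_lie_su (fun j => weight a j * weight b j) xa yb).
rewrite -lie3_tens => ->; apply: eq_bigr => e _.
by rewrite lie3_tens (coord3_tens _ _ (lie_graded xa yb)) (linearZ_LR (emb e)).
Qed.

Lemma lie3_prk a b c x y z : x \in grade a -> y \in grade b ->
  lie3 (prk (delta_so R n) (tangent R n) (lie3 (emb a x) (emb b y))) (emb c z)
    = ((a == b)%:R * (weight_norm a / 3)) *: emb c (lie (lie x y) z).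
Proof.
move=> xa yb; have [_ +] := prp_su3 (tens_lie_su (fun j => weight a j * weight b j) xa yb).
rewrite -lie3_tens => ->.
have -> : \sum_j lie3 (emb a x) (emb b y) j = (\sum_j weight a j * weight b j) *: lie x y.
  by rewrite scaler_suml; apply: eq_bigr => j _; rewrite lie3_tens ffunE.
rewrite (linearZ_LR (gproj false)) /= (linearZ_LR (gproj false)) /=.
rewrite (gproj_graded _ (lie_graded xa yb)) !scalerA.
have -> : 3^-1 * (\sum_j weight a j * weight b j) * (false == is_odd a (+) is_odd b)%:R
    = (a == b)%:R * (weight_norm a / 3).
  have [ab|ab] := eqVneq (is_odd a) (is_odd b).
    by rewrite ab addbb eqxx weight_orth // mulr1 mulrC mulrA.
  have -> : (false == is_odd a (+) is_odd b) = false.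
    by move: ab; case: is_odd; case: is_odd.
  by have [ab'|_] := eqVneq a b; [rewrite ab' eqxx in ab | rewrite mulr0 mul0r].
rewrite lie3_tens; apply/ffunP => j; rewrite ffunE [RHS]ffunE ffunE lieZl !scalerA.
by congr (_ *: _); ring.
Qed.

Lemma lie3_delta X Z : X \in delta_so R n -> Z \in tangent R n ->
  lie3 X Z \in tangent R n.
Proof.
move=> /memv_tensv[x xso ->] /tangentP[z zU ->].
rewrite (lin_sum (lie3_linr _)) rpred_sum // => a _.
have -> : lie3 (tens (fun=> 1) x) (emb a (z a)) = emb a (lie x (z a)).
  by rewrite lie3_tens; apply/ffunP => j; rewrite !ffunE mul1r.
have xg : x \in graded false by [].
by apply: emb_tangent; have := lie_graded xg (zU a).
Qed.

Lemma Q_emb a j v w : (0 < n)%N -> v \in su -> w \in su ->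
  Q (emb a v j) (emb a w j) = weight a j * weight a j * kform v w.
Proof.
move=> n0 vsu wsu; rewrite !embE Q_kform ?rpredZ //.
by rewrite kformZl kformC kformZl kformC mulrA.
Qed.

Definition metric_coef (x z u : R) (a : 'I_5) : R := [:: x; x; z; u; 1]`_a.

(** The projections sumv_pi add up to the identity and land in the summands, so
    coord3 determines them. *)
Lemma metric_coord3 x z u : (0 < n)%N ->
  {in tangent R n &, forall X Y, @metric R n x z u X Y
    = \sum_a metric_coef x z u a * weight_norm a * kform (coord3 a X) (coord3 a Y)}.
Proof.
move=> n0 X Y Xp Yp; apply: eq_bigr => a _; rewrite -mulrA; congr (_ * _).
have piE V : V \in tangent R n ->
    sumv_pi (\sum_(j < 5) summand R n j)%VS a V = emb a (coord3 a V).
  move=> Vp.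
  have piP b : exists v, (v \in grade b) && (sumv_pi (\sum_(j < 5) summand R n j)%VS b V == emb b v).
    have := memv_sum_pi (erefl (\sum_(j < 5) summand R n j)%VS) b V.
    by rewrite {1}summandE => /memv_tensv[v vb ->]; exists v; rewrite vb eqxx.
  have VE := sumv_pi_sum (erefl (\sum_(j < 5) summand R n j)%VS) Vp.
  pose v b := xchoose (piP b).
  have vU b : v b \in grade b by have /andP[] := xchooseP (piP b).
  have vE b : sumv_pi (\sum_(j < 5) summand R n j)%VS b V = emb b (v b).
    by have /andP[_ /eqP] := xchooseP (piP b).
  have {}VE : V = \sum_b emb b (v b).
    by rewrite -[LHS]VE; apply: eq_bigr => b _; rewrite vE.
  by rewrite vE [in RHS]VE coord3_sum.
rewrite !piE // /Q3.
have x_su V : V \in tangent R n -> coord3 a V \in su by move/(coord3_in a)/graded_su.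
apply: etrans (eq_bigr _ (fun j _ => Q_emb a j n0 (x_su X Xp) (x_su Y Yp))) _.
by rewrite -mulr_suml weight_orth // eqxx mul1r.
Qed.

Definition einstein_rho (x z u : R) : 'I_5 -> 'I_5 -> R :=
  rho is_odd str_const (fun a => weight_norm a / 3)
    (fun a => metric_coef x z u a * weight_norm a) (@casimir_const R n).

Lemma einstein_metric_rho x z u : (1 < n)%N -> 0 < x -> 0 < z -> 0 < u ->
    (forall b c, b != c -> einstein_rho x z u b c = 0) ->
  is_einstein_metric n x z u <->
  exists lam, forall b, einstein_rho x z u b b = lam * (metric_coef x z u b * weight_norm b).
Proof.
move=> n1 x0 z0 u0; have n0 := ltnW n1.
apply: (@einstein_chart _ _ _ _ graded lie kform is_odd lie3 _ _ _ emb coord3).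
- exact: lieC.
- exact: lie_lin.
- exact: lie_jacobi.
- exact: lie_graded.
- exact: kformC.
- exact: kform_linl.
- exact: kform_lie.
- by move=> o v /graded_su vsu; apply: kform_ge0.
- by move=> o v /graded_su vsu; apply: kform_eq0.
- by move=> o; apply: graded_neq0.
- by move=> o o' v w; apply: vtrace_graded.
- exact: lie3_linl.
- exact: lie3_linr.
- exact: emb_tangent.
- exact: coord3_in.
- exact: emb_coord3.
- exact: coord3_emb.
- exact: str_const_par.
- exact: prp_lie3.
- by move=> a b c v w y va wb _; apply: lie3_prk.
- exact: lie3_delta.
- exact: metric_coord3.
move=> a; rewrite mulr_gt0 ?weight_norm_gt0 // /metric_coef.
by case: a => [[|[|[|[|[|//]]]]] ?] /=; rewrite ?ltr01.
Qed.

End Chart.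

(** * The Ricci eigenvalues *)

(** Scalars in which the zero coming from a vanishing structure constant is the
    constructor None: sums over all indices then shrink by computation to their
    few nonzero terms before any field arithmetic is done. *)
Section SparseScalars.
Variable R : realType.

Definition sparse_val (o : option R) : R := odflt 0 o.

Definition sadd (o o' : option R) : option R :=
  match o, o' with
  | Some r, Some r' => Some (r + r') | None, _ => o' | _, None => o end.

Definition smul (o o' : option R) : option R :=
  match o, o' with Some r, Some r' => Some (r * r') | _, _ => None end.

Definition ssum (s : seq (option R)) : option R := foldr sadd None s.

Lemma sparse_valD o o' : sparse_val (sadd o o') = sparse_val o + sparse_val o'.
Proof. by case: o o' => [r|] [r'|] //=; rewrite ?addr0 ?add0r. Qed.

Lemma sparse_valM o o' : sparse_val (smul o o') = sparse_val o * sparse_val o'.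
Proof. by case: o o' => [r|] [r'|] //=; rewrite ?mulr0 ?mul0r. Qed.

Lemma sparse_val_sum m (f : nat -> option R) :
  sparse_val (ssum [seq f i | i <- iota 0 m]) = \sum_(i < m) sparse_val (f i).
Proof.
rewrite -(big_mkord xpredT (fun i => sparse_val (f i))) /index_iota subn0.
by elim: (iota 0 m) => [|i s IH]; rewrite ?big_nil ?big_cons //= sparse_valD IH.
Qed.

End SparseScalars.

Section RicciTable.
Variables (R : realType) (n : nat).

(** The symmetric tensor of the sums of products of three weights, restricted to
    triples with an even number of indices of odd grade. *)
Definition triple_weight (a b c : nat) : option R :=
  match a, b, c with
  | 0, 0, 3 | 0, 3, 0 | 3, 0, 0 => Some 1
  | 1, 1, 3 | 1, 3, 1 | 3, 1, 1 => Some (-1)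
  | 0, 0, 4 | 0, 4, 0 | 4, 0, 0 => Some 1
  | 1, 1, 4 | 1, 4, 1 | 4, 1, 1 => Some 1
  | 2, 2, 4 | 2, 4, 2 | 4, 2, 2 => Some (-2)
  | 3, 3, 4 | 3, 4, 3 | 4, 3, 3 => Some 2
  | 4, 4, 4 => Some (-6)
  | _, _, _ => None
  end.

Local Notation tw a b c := (sparse_val (triple_weight a b c)).
Local Notation N a := (nth (0 : R) [:: 1; 1; 1; 2; 6] a).

Lemma str_constE (a b c : 'I_5) :
  str_const R a b c = tw a b c / weight_norm R c.
Proof.
rewrite /str_const sum3 mulrA; congr (_ / _).
by case: a b c => [[|[|[|[|[|//]]]]] ?] [[|[|[|[|[|//]]]]] ?] [[|[|[|[|[|//]]]]] ?];
  rewrite /is_odd /weight /=; ring.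
Qed.

Definition lc_coef_factor (x z u : R) (a b c : nat) : R :=
  let g i := [:: x; x; z; u; 1]`_i in (g c + g b - g a) / (2 * g c * N c).

Definition lc_coef_sparse (x z u : R) (a b c : nat) : option R :=
  smul (triple_weight a b c) (Some (lc_coef_factor x z u a b c)).

Lemma triple_weightC a b c : triple_weight c a b = triple_weight a b c.
Proof. by case: a b c => [|[|[|[|[|?]]]]] [|[|[|[|[|?]]]]] [|[|[|[|[|?]]]]]. Qed.

Lemma triple_weightR a b c : triple_weight c b a = triple_weight a b c.
Proof. by case: a b c => [|[|[|[|[|?]]]]] [|[|[|[|[|?]]]]] [|[|[|[|[|?]]]]]. Qed.

Lemma lc_coefE x z u (a b c : 'I_5) : 0 < x -> 0 < z -> 0 < u ->
  lc_coef (str_const R) (fun a => metric_coef x z u a * weight_norm R a) a b c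
   = sparse_val (lc_coef_sparse x z u a b c).
Proof.
move=> x0 z0 u0; rewrite /lc_coef !str_constE (triple_weightC a b c) (triple_weightR a b c) /lc_coef_sparse sparse_valM /= /lc_coef_factor.
rewrite -/(metric_coef x z u a) -/(metric_coef x z u b) -/(metric_coef x z u c).
rewrite -/(weight_norm R c).
have N0 d : weight_norm R d != 0 by rewrite gt_eqF ?weight_norm_gt0.
field; rewrite !N0 /= /metric_coef.
by case: c => [[|[|[|[|[|//]]]]] ?] /=; rewrite ?oner_eq0 ?gt_eqF.
Qed.

Definition rho_sparse (x z u : R) (b c : nat) : option R :=
  ssum [seq smul (Some (casimir_const R n (a < 3)%N (b < 3)%N)) (sadd
    (ssum [seq sadd
        (smul (smul (triple_weight a b e) (Some (N e)^-1)) (lc_coef_sparse x z u e c a))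
        (smul (Some (-1)) (smul (lc_coef_sparse x z u a c e) (lc_coef_sparse x z u b e a)))
      | e <- iota 0 5])
    (if (a == b) && (a == c) then Some (N a / 3) else None)) | a <- iota 0 5].

Lemma einstein_rhoE (x z u : R) (b c : 'I_5) : 0 < x -> 0 < z -> 0 < u ->
  einstein_rho n x z u b c = sparse_val (rho_sparse x z u b c).
Proof.
move=> x0 z0 u0; rewrite sparse_val_sum; apply: eq_bigr => a _.
rewrite sparse_valM sparse_valD sparse_val_sum; congr (_ * (_ + _)).
  apply: eq_bigr => e _.
  by rewrite !lc_coefE // str_constE sparse_valD !sparse_valM mulN1r.
rewrite -!val_eqE /=; case: eqP => _; case: eqP => _ /=;
  by rewrite ?mulr1 ?mul1r ?mulr0 ?mul0r.
Qed.

Lemma einstein_rho_off (x z u : R) (b c : 'I_5) :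
  (0 < n)%N -> 0 < x -> 0 < z -> 0 < u -> b != c -> einstein_rho n x z u b c = 0.
Proof.
move=> n0 x0 z0 u0 bc; rewrite einstein_rhoE //.
have [x_n0 z_n0 u_n0] : [/\ x != 0, z != 0 & u != 0] by rewrite !gt_eqF.
have n_n0 : n%:R != 0 :> R by rewrite pnatr_eq0 -lt0n.
case: b c bc => [[|[|[|[|[|//]]]]] ?] [[|[|[|[|[|//]]]]] ?] //= _.
all: by rewrite /lc_coef_factor /casimir_const /=; field; rewrite ?x_n0 ?u_n0.
Qed.

(** The Ricci tensor is ric_eigenvalue b times the metric on summand b.  Here c is the
    ratio of the Killing forms of so and su on so. *)
Definition ric_eigenvalue (x z u : R) (b : 'I_5) : R :=
  let c := (n%:R - 2) / (2 * n%:R) in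
  let rx := 1 / (2 * x) - (3 * u + 1) / (24 * x ^+ 2) in
  [:: rx; rx; 1 / (2 * z) - 1 / (6 * z ^+ 2);
      c * (6 * u - 1) / (12 * u ^+ 2) + (1 - c) * u / (4 * x ^+ 2);
      c * (9 * u ^+ 2 + 1) / (24 * u ^+ 2) + (1 - c) * (1 / x ^+ 2 + 2 / z ^+ 2) / 12]`_b.

Lemma einstein_rho_diag (x z u : R) (b : 'I_5) :
  (0 < n)%N -> 0 < x -> 0 < z -> 0 < u ->
  einstein_rho n x z u b b = ric_eigenvalue x z u b * (metric_coef x z u b * weight_norm R b).
Proof.
move=> n0 x0 z0 u0; rewrite einstein_rhoE //.
have [x_n0 z_n0 u_n0] : [/\ x != 0, z != 0 & u != 0] by rewrite !gt_eqF.
have n_n0 : n%:R != 0 :> R by rewrite pnatr_eq0 -lt0n.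
rewrite /ric_eigenvalue /metric_coef /weight_norm.
case: b => [[|[|[|[|[|//]]]]] ?] //=.
all: by rewrite /lc_coef_factor /casimir_const /=; field; rewrite ?x_n0 ?u_n0 ?z_n0 ?n_n0 /=.
Qed.

Lemma einstein_metricE (x z u : R) : (1 < n)%N -> 0 < x -> 0 < z -> 0 < u ->
  is_einstein_metric n x z u <->
  exists lam, forall b, ric_eigenvalue x z u b = lam.
Proof.
move=> n1 x0 z0 u0; have n0 := ltnW n1.
have gN0 b : metric_coef x z u b * weight_norm R b != 0.
  rewrite mulf_neq0 ?(gt_eqF (weight_norm_gt0 _ _)) // /metric_coef.
  by case: b => [[|[|[|[|[|//]]]]] ?] /=; rewrite ?oner_eq0 ?gt_eqF.
have [to_rho of_rho] := @einstein_metric_rho R n x z u n1 x0 z0 u0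
  (fun b c => einstein_rho_off n0 x0 z0 u0).
split=> [/to_rho[lam rho_lam]|[lam ric_lam]].
  exists lam => b; apply: (mulIf (gN0 b)).
  by rewrite -rho_lam einstein_rho_diag.
by apply: of_rho; exists lam => b; rewrite einstein_rho_diag // ric_lam.
Qed.

End RicciTable.

(** * Signs of polynomials by nonnegative coefficients *)

(** A polynomial in t and m with nonnegative integer coefficients and positive
    constant term is positive for t, m >= 0.  The polynomials met below have too many large
    coefficients to be written out, so a formal expression is expanded to its
    coefficients by computation and the signs are tested on the result. *)
Section PositiveCoefficients.

Inductive pexp := PVar of nat | PCst of nat
  | PAdd of pexp & pexp | PSub of pexp & pexp | PMul of pexp & pexp.

Fixpoint pev (T : comNzRingType) (env : seq T) (e : pexp) : T :=
  match e with
  | PVar i => env`_i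
  | PCst k => k%:R
  | PAdd e1 e2 => pev env e1 + pev env e2
  | PSub e1 e2 => pev env e1 - pev env e2
  | PMul e1 e2 => pev env e1 * pev env e2
  end.

Section ListPolynomials.
Variables (A : Type) (zero : A) (add mul : A -> A -> A) (opp : A -> A).

Fixpoint lp_add (s t : seq A) : seq A :=
  match s, t with
  | a :: s', b :: t' => add a b :: lp_add s' t'
  | [::], _ => t
  | _, [::] => s
  end.

Fixpoint lp_mul (s t : seq A) : seq A :=
  if s is a :: s' then lp_add (map (mul a) t) (zero :: lp_mul s' t) else [::].

Variables (R : realType) (f : A -> R).
Hypothesis f0 : f zero = 0.
Hypothesis fD : forall a b, f (add a b) = f a + f b.
Hypothesis fM : forall a b, f (mul a b) = f a * f b.
Hypothesis fN : forall a, f (opp a) = - f a.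

Definition lp_eval (x : R) (s : seq A) : R := foldr (fun a r => f a + x * r) 0 s.

Lemma lp_evalD x s t : lp_eval x (lp_add s t) = lp_eval x s + lp_eval x t.
Proof.
elim: s t => [|a s IH] [|b t] //=; rewrite ?add0r ?addr0 // fD IH; ring.
Qed.

Lemma lp_evalM x s t : lp_eval x (lp_mul s t) = lp_eval x s * lp_eval x t.
Proof.
elim: s => [|a s IH] /=; first by rewrite mul0r.
rewrite lp_evalD /= IH f0 add0r.
have -> : lp_eval x (map (mul a) t) = f a * lp_eval x t.
  by elim: t {IH} => [|b t IH] /=; rewrite ?mulr0 // fM IH; ring.
by ring.
Qed.

Lemma lp_evalN x s : lp_eval x (map opp s) = - lp_eval x s.
Proof. by elim: s => [|a s IH] /=; rewrite ?oppr0 // fN IH; ring. Qed.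

End ListPolynomials.

(** A polynomial in t whose coefficients are polynomials in m, both dense and with
    the constant term first. *)
Definition bpoly := seq (seq Z).

Definition zp_add := lp_add Z.add.
Definition zp_mul := lp_mul Z0 Z.add Z.mul.
Definition bp_add : bpoly -> bpoly -> bpoly := lp_add zp_add.
Definition bp_mul : bpoly -> bpoly -> bpoly := lp_mul [::] zp_add zp_mul.
Definition bp_opp : bpoly -> bpoly := map (map Z.opp).

Fixpoint pnorm (env : seq bpoly) (e : pexp) : bpoly :=
  match e with
  | PVar i => nth [::] env i
  | PCst k => [:: [:: Z.of_nat k]]
  | PAdd e1 e2 => bp_add (pnorm env e1) (pnorm env e2)
  | PSub e1 e2 => bp_add (pnorm env e1) (bp_opp (pnorm env e2))
  | PMul e1 e2 => bp_mul (pnorm env e1) (pnorm env e2)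
  end.

Variable R : realType.

Definition zval (z : Z) : R := (int_of_Z z)%:~R.
Definition zp_eval (m : R) : seq Z -> R := lp_eval zval m.
Definition bp_eval (m t : R) : bpoly -> R := lp_eval (zp_eval m) t.

Lemma zvalD a b : zval (Z.add a b) = zval a + zval b.
Proof. by rewrite /zval -intrD -rmorphD. Qed.

Lemma zvalM a b : zval (Z.mul a b) = zval a * zval b.
Proof. by rewrite /zval -intrM -rmorphM. Qed.

Lemma zvalN a : zval (Z.opp a) = - zval a.
Proof. by rewrite /zval -mulrNz -rmorphN. Qed.

Lemma zval_nat k : zval (Z.of_nat k) = k%:R.
Proof. by rewrite /zval; have -> : int_of_Z (Z.of_nat k) = k by lia. Qed.

Lemma zval_ge0 z : Z.leb Z0 z -> 0 <= zval z.
Proof. by move=> z0; rewrite /zval ler0z; lia. Qed.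

Lemma zval_gt0 z : Z.ltb Z0 z -> 0 < zval z.
Proof. by move=> z0; rewrite /zval ltr0z; lia. Qed.

Lemma pnormE m t env e :
  bp_eval m t (pnorm env e) = pev (map (bp_eval m t) env) e.
Proof.
have zD a b : zp_eval m (zp_add a b) = zp_eval m a + zp_eval m b.
  exact/lp_evalD/zvalD.
have zM a b : zp_eval m (zp_mul a b) = zp_eval m a * zp_eval m b.
  by apply: lp_evalM; [|exact: zvalD|exact: zvalM].
have zN a : zp_eval m (map Z.opp a) = - zp_eval m a by exact/lp_evalN/zvalN.
elim: e => [i|k|e1 IH1 e2 IH2|e1 IH1 e2 IH2|e1 IH1 e2 IH2] /=.
- have [i_lt|i_ge] := ltnP i (size env); first by rewrite (nth_map [::]).
  by rewrite !nth_default ?size_map.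
- by rewrite /bp_eval /zp_eval /= zval_nat !mulr0 !addr0.
- by rewrite -IH1 -IH2; apply: lp_evalD.
- rewrite -IH1 -IH2 -(lp_evalN zN); exact: lp_evalD.
- by rewrite -IH1 -IH2; apply: lp_evalM.
Qed.

Definition bp_pos (p : bpoly) : bool :=
  all (all (Z.leb Z0)) p && Z.ltb Z0 (head Z0 (head [::] p)).

Lemma zp_eval_ge0 m s : 0 <= m -> all (Z.leb Z0) s -> 0 <= zp_eval m s.
Proof.
move=> m0; elim: s => //= z s IH /andP[z0 s0].
by rewrite addr_ge0 ?zval_ge0 // mulr_ge0 // IH.
Qed.

Lemma bp_eval_ge0 m t p : 0 <= m -> 0 <= t -> all (all (Z.leb Z0)) p -> 0 <= bp_eval m t p.
Proof.
move=> m0 t0; elim: p => //= s p IH /andP[s0 p0].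
by rewrite addr_ge0 ?zp_eval_ge0 // mulr_ge0 // IH.
Qed.

Lemma bp_pos_gt0 m t p : 0 <= m -> 0 <= t -> bp_pos p -> 0 < bp_eval m t p.
Proof.
move=> m0 t0; case: p => [|[|z s] p]; rewrite /bp_pos //= ?andbF //.
move=> /andP[/andP[/andP[_ s0] p0] z0].
rewrite ltr_wpDr ?mulr_ge0 ?bp_eval_ge0 //.
by rewrite ltr_wpDr ?zval_gt0 // mulr_ge0 ?zp_eval_ge0.
Qed.

Lemma bp_eval_homo m t t' p : 0 <= m -> 0 <= t -> t <= t' ->
  all (all (Z.leb Z0)) p -> bp_eval m t p <= bp_eval m t' p.
Proof.
move=> m0 t0 tt'; elim: p => //= s p IH /andP[s0 p0].
by rewrite lerD2l ler_pM ?bp_eval_ge0 ?IH.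
Qed.

(** If all coefficients but the one of t^0 are nonnegative, the polynomial is increasing; its
    constant term may have any sign.  This is what gives uniqueness of a root. *)
Lemma bp_eval_lt m t t' p : 0 <= m -> 0 <= t -> t < t' ->
  bp_pos (behead p) -> bp_eval m t p < bp_eval m t' p.
Proof.
move=> m0 t0 tt'; case: p => [|s p] //= p_pos.
have /andP[p0 _] := p_pos.
have p_gt0 := bp_pos_gt0 m0 (le_trans t0 (ltW tt')) p_pos.
rewrite ltrD2l; apply: le_lt_trans (_ : t * bp_eval m t' p < _).
  by rewrite ler_wpM2l // bp_eval_homo // ltW.
by rewrite ltr_pM2r.
Qed.

End PositiveCoefficients.

(** * Locating the roots of a polynomial of degree ten *)
Declare Scope pexp_scope.
Delimit Scope pexp_scope with P.
Bind Scope pexp_scope with pexp.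
Notation "a + b" := (PAdd a b) : pexp_scope.
Notation "a - b" := (PSub a b) : pexp_scope.
Notation "a * b" := (PMul a b) : pexp_scope.

Section Certificates.

Definition var_n := PVar 0.
Definition var_w := PVar 1.
Definition var_d := PVar 2.

(** The polynomials below are homogenised by var_d, of value 1 at the end.  For
    u <> 1 and w = u / x, one Einstein equation is 6 u m_poly = nu_poly, and eliminating
    u and z from the others leaves g_poly = 0.  At a root, 1 - u = q_poly / (6 m_poly)
    and zeta_poly is 8 (n + 2) m_poly * nu_poly times u / z, so their signs decide
    whether u < 1 and whether z > 0. *)
Definition m_poly : pexp :=
  ((var_n + PCst 1) * var_w * var_w - PCst 2 * var_n * var_w * var_d + (var_n - PCst 2) * var_d * var_d)%P.
Definition nu_poly : pexp := ((var_n - PCst 2) * var_d * var_d - var_n * var_w * var_w)%P.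
Definition q_poly : pexp := (PCst 6 * m_poly - nu_poly)%P.
Definition p_poly : pexp :=
  (PCst 2 * (var_n + PCst 2) * m_poly * var_w * var_w
   + (var_n - PCst 2) * (var_w - var_d) * ((PCst 3 * var_n + PCst 2) * var_w - (var_n - PCst 2) * var_d) * var_d * var_d)%P.
Definition g_poly : pexp :=
  (PCst 4 * (var_n + PCst 2) * nu_poly * nu_poly * (p_poly + PCst 2 * (var_n + PCst 2) * m_poly * var_w * var_w) * var_d * var_d
   - PCst 16 * (var_n + PCst 2) * m_poly * nu_poly * var_w * p_poly * var_d + q_poly * p_poly * p_poly)%P.
Definition zeta_poly : pexp := (PCst 8 * (var_n + PCst 2) * m_poly * nu_poly * var_w * var_d - q_poly * p_poly)%P.

Lemma horner_pev (R : realType) (env : seq {poly R}) e w :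
  (pev env e).[w] = pev [seq p.[w] | p : {poly R} <- env] e.
Proof.
elim: e => [i|k|e1 IH1 e2 IH2|e1 IH1 e2 IH2|e1 IH1 e2 IH2] /=;
  rewrite ?hornerE ?IH1 ?IH2 //; last by rewrite -polyC_natr hornerC.
have [i_lt|i_ge] := ltnP i (size env); first by rewrite (nth_map 0).
by rewrite !nth_default ?size_map // horner0.
Qed.

(** The polynomial a + b m.  All endpoints are quotients of two of these, and m
    stands for n - 3. *)
Definition lin (a b : nat) : seq Z := [:: Z.of_nat a; Z.of_nat b].

Definition bn : bpoly := [:: lin 3 1].

(** For t >= 0 the fraction (ln hd + t hn ld) / (ld hd (1 + t)) runs over the
    interval from ln / ld to hn / hd, so signs of the coefficients of this
    polynomial in t and m control e there for all n >= 3 at once. *)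
Definition segment (ln ld hn hd : seq Z) (e : pexp) : bpoly :=
  pnorm [:: bn; [:: zp_mul ln hd; zp_mul hn ld]; [:: zp_mul ld hd; zp_mul ld hd]] e.

Definition point (ln ld : seq Z) (e : pexp) : bpoly :=
  pnorm [:: bn; [:: ln]; [:: ld]] e.

Variables (R : realType) (n : R).
Hypothesis n_ge3 : 3 <= n.
Local Notation ev l := (zp_eval (n - 3) l).
Local Notation at_ w e := (pev [:: n; w; 1] e).
Local Notation homogeneous k e := (forall w d : R, pev [:: n; w * d; d] e = d ^+ k * at_ w e).

Let n3 : 0 <= n - 3. Proof. by rewrite subr_ge0. Qed.

Lemma linE a b : ev (lin a b) = a%:R + b%:R * (n - 3).
Proof. by rewrite /zp_eval /lp_eval /= !zval_nat mulr0 addr0 [_ * b%:R]mulrC. Qed.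

Lemma bnE t : bp_eval (n - 3) t bn = n.
Proof.
have -> : bp_eval (n - 3) t bn = ev (lin 3 1) by rewrite /bp_eval /bn /lp_eval /foldr mulr0 addr0.
by rewrite linE; ring.
Qed.

Lemma zp_evalM a b : ev (zp_mul a b) = ev a * ev b.
Proof. by apply: lp_evalM; [|exact: zvalD|exact: zvalM]. Qed.

Lemma segmentE ln ld hn hd e t : bp_eval (n - 3) t (segment ln ld hn hd e) =
  pev [:: n; ev ln * ev hd + t * (ev hn * ev ld); ev ld * ev hd * (1 + t)] e.
Proof.
apply: etrans (pnormE _ _ _ _) _; rewrite !map_cons bnE /bp_eval /lp_eval /=.
by rewrite !zp_evalM !mulr0 !addr0; congr (pev [:: _; _; _] _); ring.
Qed.

Lemma pointE ln ld e : bp_eval (n - 3) 0 (point ln ld e) = pev [:: n; ev ln; ev ld] e.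
Proof.
apply: etrans (pnormE _ _ _ _) _; rewrite !map_cons bnE /bp_eval /lp_eval /=.
by rewrite !mul0r !addr0.
Qed.

Lemma segment_param ln ld hn hd w : 0 < ev ld -> 0 < ev hd ->
    ev ln <= w * ev ld -> w * ev hd < ev hn ->
  exists t, [/\ 0 <= t, 0 < ev ld * ev hd * (1 + t)
    & ev ln * ev hd + t * (ev hn * ev ld) = w * (ev ld * ev hd * (1 + t))].
Proof.
move=> ld0 hd0 lw wh.
(* t solves w = (lo + t hi) / (1 + t), that is t = (w - lo) / (hi - w). *)
exists ((w * ev ld - ev ln) * ev hd / ((ev hn - w * ev hd) * ev ld)).
have t0 : 0 <= (w * ev ld - ev ln) * ev hd / ((ev hn - w * ev hd) * ev ld).
  by rewrite divr_ge0 // mulr_ge0 // ?subr_ge0 // ltW.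
split=> //; first by rewrite !mulr_gt0 // ltr_wpDr.
by field; rewrite (gt_eqF ld0) gt_eqF // subr_gt0.
Qed.

Lemma segment_gt0 k e ln ld hn hd w : homogeneous k e -> 0 < ev ld -> 0 < ev hd ->
    bp_pos (segment ln ld hn hd e) -> ev ln <= w * ev ld -> w * ev hd < ev hn ->
  0 < at_ w e.
Proof.
move=> e_hom ld0 hd0 e_pos lw wh.
have [t [t0 d0 wd]] := segment_param ld0 hd0 lw wh.
have := bp_pos_gt0 n3 t0 e_pos; rewrite segmentE wd e_hom.
by rewrite pmulr_rgt0 // exprn_gt0.
Qed.

Lemma point_gt0 k e ln ld : homogeneous k e -> 0 < ev ld -> bp_pos (point ln ld e) ->
  0 < at_ (ev ln / ev ld) e.
Proof.
move=> e_hom ld0 e_pos; have := bp_pos_gt0 n3 (lexx 0) e_pos.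
by rewrite pointE -{1}[ev ln](divfK (lt0r_neq0 ld0)) e_hom pmulr_rgt0 // exprn_gt0.
Qed.

Lemma segment_root_unique k e ln ld hn hd w w' : homogeneous k e ->
    0 < ev ld -> 0 < ev hd -> bp_pos (behead (segment ln ld hn hd e)) ->
    ev ln <= w * ev ld -> w * ev hd < ev hn ->
    ev ln <= w' * ev ld -> w' * ev hd < ev hn ->
  at_ w e = 0 -> at_ w' e = 0 -> w = w'.
Proof.
move=> e_hom ld0 hd0 e_pos lw wh lw' wh' ew ew'.
have [t [t0 d0 wd]] := segment_param ld0 hd0 lw wh.
have [t' [t0' d0' wd']] := segment_param ld0 hd0 lw' wh'.
have root_t : bp_eval (n - 3) t (segment ln ld hn hd e) = 0.
  by rewrite segmentE wd e_hom ew mulr0.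
have root_t' : bp_eval (n - 3) t' (segment ln ld hn hd e) = 0.
  by rewrite segmentE wd' e_hom ew' mulr0.
case: (ltgtP t t') => [tt'|tt'|tt'].
- by have := bp_eval_lt n3 t0 tt' e_pos; rewrite root_t root_t' ltxx.
- by have := bp_eval_lt n3 t0' tt' e_pos; rewrite root_t root_t' ltxx.
by apply: (mulIf (lt0r_neq0 d0)); rewrite -wd tt' wd'.
Qed.

Lemma m_poly_hom : homogeneous 2 m_poly. Proof. by move=> w d /=; ring. Qed.
Lemma nu_poly_hom : homogeneous 2 nu_poly. Proof. by move=> w d /=; ring. Qed.
Lemma q_poly_hom : homogeneous 2 q_poly. Proof. by move=> w d /=; ring. Qed.
Lemma g_poly_hom : homogeneous 10 g_poly.
Proof. by move=> w d /=; ring. Qed.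
Lemma zeta_poly_hom : homogeneous 6 zeta_poly. Proof. by move=> w d /=; ring. Qed.

Lemma homogeneous_neg k e : homogeneous k e -> homogeneous k (PCst 0 - e)%P.
Proof. by move=> e_hom w d /=; rewrite e_hom !sub0r mulrN. Qed.

Lemma lin_gt0 a b : (0 < a)%N -> 0 < ev (lin a b).
Proof.
move=> a_gt0; rewrite linE; have a0 : 0 < a%:R :> R by rewrite ltr0n.
have b0 : 0 <= b%:R * (n - 3) by rewrite mulr_ge0 ?ler0n ?n3.
by lra.
Qed.

Local Notation neg e := (PCst 0 - e)%P.
Local Notation lin_pos a b := (lin_gt0 b (isT : (0 < a)%N)).

Lemma at_neg e w : at_ w (neg e) = - at_ w e. Proof. exact: sub0r. Qed.

(** The intermediate value theorem; the endpoints are excluded because g_poly does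
    not vanish there. *)
Lemma g_ivt a b : a <= b -> at_ a g_poly * at_ b g_poly < 0 ->
  exists w, [/\ a < w, w < b & at_ w g_poly = 0].
Proof.
move=> ab sgn.
have gP w : (pev [:: n%:P; 'X; 1] g_poly).[w] = at_ w g_poly.
  by rewrite horner_pev /= !hornerE.
pose P : {poly R} := pev [:: n%:P; 'X; 1] g_poly.
have [w /andP[aw wb] Pw] : exists2 w, a <= w <= b & root P w.
  have [ga0|ga0] := lerP (at_ a g_poly) 0.
    apply: poly_ivt => //; rewrite !gP ga0 /= leNgt; apply: contraTN sgn => gb0.
    by rewrite -leNgt mulr_le0 // ltW.
  have [w wab Pw] : exists2 w, a <= w <= b & root (- P) w.
    apply: poly_ivt => //; rewrite !hornerN !gP oppr_le0 oppr_ge0 (ltW ga0) /=.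
    by rewrite -(pmulr_rle0 _ ga0) ltW.
  by exists w => //; rewrite -rootN.
have gw : at_ w g_poly = 0 by rewrite -gP; apply/eqP.
exists w; split=> //.
  by rewrite lt_neqAle aw andbT; apply: contraTneq sgn => ->; rewrite gw mul0r ltxx.
by rewrite lt_neqAle wb andbT; apply: contraTneq sgn => <-; rewrite gw mulr0 ltxx.
Qed.

(** A root between (n - 2) / (3n + 2) and (n - 2) / (n + 1). *)
Definition left_root (w : R) : Prop :=
  [/\ ev (lin 1 1) < w * ev (lin 11 3), w * ev (lin 4 1) < ev (lin 1 1) & at_ w g_poly = 0].

Definition right_root (w : R) : Prop := [/\ 1 < w, w < 3 & at_ w g_poly = 0].

(** The interval of left_root is cut at 5(n - 2) / (8n + 30), slightly below the
    root for every n: with denominators cleared, the coefficients of g_poly in t and m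
    are nonnegative before this point, and -g_poly is increasing in t after it. *)
Lemma left_root_gt w : left_root w -> ev (lin 5 5) <= w * ev (lin 54 8).
Proof.
move=> [w_lo _ gw]; rewrite leNgt; apply/negP => w_hi.
suff : 0 < at_ w g_poly by rewrite gw ltxx.
apply: (segment_gt0 g_poly_hom (lin_pos 11 3) (lin_pos 54 8) _ (ltW w_lo) w_hi).
by vm_compute.
Qed.

Lemma left_root_unique w w' : left_root w -> left_root w' -> w = w'.
Proof.
move=> rw rw'; have [_ w_hi gw] := rw; have [_ w_hi' gw'] := rw'.
apply: (segment_root_unique (homogeneous_neg g_poly_hom) (lin_pos 54 8) (lin_pos 4 1) _
  (left_root_gt rw) w_hi (left_root_gt rw') w_hi').
- by vm_compute.
- by rewrite at_neg gw oppr0.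
- by rewrite at_neg gw' oppr0.
Qed.

(** Likewise, with the opposite signs, the interval from 1 to 3 is cut at
    (2n + 21) / (2n + 16). *)
Lemma right_root_gt w : right_root w -> ev (lin 27 2) <= w * ev (lin 22 2).
Proof.
move=> [w_lo _ gw]; rewrite leNgt; apply/negP => w_hi.
suff : 0 < at_ w (neg g_poly) by rewrite at_neg gw oppr0 ltxx.
apply: (segment_gt0 (ln := lin 1 0) (homogeneous_neg g_poly_hom) (lin_pos 1 0) (lin_pos 22 2) _ _ w_hi).
  by vm_compute.
by rewrite !linE; lra.
Qed.

Lemma right_root_unique w w' : right_root w -> right_root w' -> w = w'.
Proof.
move=> rw rw'; have [_ w_hi gw] := rw; have [_ w_hi' gw'] := rw'.
apply: (segment_root_unique (hn := lin 3 0) (hd := lin 1 0) g_poly_hom (lin_pos 22 2) (lin_pos 1 0) _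
  (right_root_gt rw) _ (right_root_gt rw') _ gw gw').
- by vm_compute.
- by rewrite !linE; lra.
- by rewrite !linE; lra.
Qed.

(** Sign change between 5(n - 2) / (8n + 30) and 2(n - 2) / (3n + 6).  The second point is small
    enough for q_poly to be positive up to it, which will give u < 1. *)
Lemma left_root_exists : exists2 w, left_root w &
  [/\ 0 < w, 0 < at_ w m_poly, 0 < at_ w nu_poly, 0 < at_ w q_poly & 0 < at_ w zeta_poly].
Proof.
have A0 := lin_pos 54 8; have B0 := lin_pos 15 3.
have [||w [w_lo w_hi gw]] := @g_ivt (ev (lin 5 5) / ev (lin 54 8)) (ev (lin 2 2) / ev (lin 15 3)).
- by rewrite ler_pdivrMr // mulrAC ler_pdivlMr // !linE; move: n3; move: (n - 3) => m m0; nra.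
- rewrite pmulr_rlt0; last by apply: (point_gt0 g_poly_hom); [exact: lin_gt0 | vm_compute].
  by rewrite -oppr_gt0 -at_neg; apply: (point_gt0 (homogeneous_neg g_poly_hom)); [exact: lin_gt0 | vm_compute].
have {}w_lo : ev (lin 5 5) <= w * ev (lin 54 8) by rewrite -ler_pdivrMr // ltW.
have {}w_hi : w * ev (lin 15 3) < ev (lin 2 2) by rewrite -ltr_pdivlMr.
have seg (k : nat) (e : pexp) : homogeneous k e ->
    bp_pos (segment (lin 5 5) (lin 54 8) (lin 2 2) (lin 15 3) e) -> 0 < at_ w e.
  by move=> e_hom e_pos; apply: (segment_gt0 e_hom A0 B0 e_pos).
have w0 : 0 < w.
  by rewrite -(pmulr_lgt0 w A0); apply: lt_le_trans w_lo; apply: lin_gt0.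
exists w; first split=> //.
- by move: w_lo; rewrite !linE; move: n3; move: (n - 3) => m m0; nra.
- by move: w_hi; rewrite !linE; move: n3; move: (n - 3) => m m0; nra.
split=> //.
- by apply: (seg 2%N m_poly m_poly_hom); vm_compute.
- by apply: (seg 2%N nu_poly nu_poly_hom); vm_compute.
- by apply: (seg 2%N q_poly q_poly_hom); vm_compute.
- by apply: (seg 6%N zeta_poly zeta_poly_hom); vm_compute.
Qed.

(** Sign change between (2n + 21) / (2n + 16) and (4n + 41) / (4n + 29).  The upper
    end must stay below the point where zeta_poly changes sign, which for n = 3 is close
    to the root. *)
Lemma right_root_exists : exists2 w, right_root w &
  [/\ 0 < w, at_ w m_poly < 0, at_ w nu_poly < 0, 0 < at_ w q_poly & 0 < at_ w zeta_poly].
Proof.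
have A0 := lin_pos 22 2; have B0 := lin_pos 41 4.
have [||w [w_lo w_hi gw]] := @g_ivt (ev (lin 27 2) / ev (lin 22 2)) (ev (lin 53 4) / ev (lin 41 4)).
- by rewrite ler_pdivrMr // mulrAC ler_pdivlMr // !linE; move: n3; move: (n - 3) => m m0; nra.
- rewrite nmulr_rlt0; first by apply: (point_gt0 g_poly_hom); [exact: lin_gt0 | vm_compute].
  by rewrite -oppr_gt0 -at_neg; apply: (point_gt0 (homogeneous_neg g_poly_hom)); [exact: lin_gt0 | vm_compute].
have {}w_lo : ev (lin 27 2) <= w * ev (lin 22 2) by rewrite -ler_pdivrMr // ltW.
have {}w_hi : w * ev (lin 41 4) < ev (lin 53 4) by rewrite -ltr_pdivlMr.
have seg (k : nat) (e : pexp) : homogeneous k e ->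
    bp_pos (segment (lin 27 2) (lin 22 2) (lin 53 4) (lin 41 4) e) -> 0 < at_ w e.
  by move=> e_hom e_pos; apply: (segment_gt0 e_hom A0 B0 e_pos).
have w1 : 1 < w by move: w_lo; rewrite !linE; move: n3; move: (n - 3) => m m0; nra.
exists w; first split=> //.
- by move: w_hi; rewrite !linE; move: n3; move: (n - 3) => m m0; nra.
split=> //.
- by apply: lt_trans w1.
- by rewrite -oppr_gt0 -at_neg; apply: (seg 2%N _ (homogeneous_neg m_poly_hom)); vm_compute.
- by rewrite -oppr_gt0 -at_neg; apply: (seg 2%N _ (homogeneous_neg nu_poly_hom)); vm_compute.
- by apply: (seg 2%N q_poly q_poly_hom); vm_compute.
- by apply: (seg 6%N zeta_poly zeta_poly_hom); vm_compute.
Qed.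

End Certificates.

(** * The Einstein equations *)
Section EinsteinSystem.
Variables (R : realType) (n : R).
Hypothesis n_ge3 : 3 <= n.
Local Notation at_ w e := (pev [:: n; w; 1] e).

(** The Einstein equations in u, w = u / x and y = u / z.  They compare the Ricci
    eigenvalues of the first copies of sq and of so, of the two copies of so, and of
    the first and the third copy of sq. *)
Definition einstein_system (u w y : R) : Prop :=
  [/\ 6 * u * at_ w m_poly = at_ w nu_poly,
      4 * (n + 2) * y ^+ 2 = (3 * u - 1) * (2 * (n + 2) * w ^+ 2 + 3 * (n - 2) * (1 - u))
    & 12 * u * (w - y) = (3 * u + 1) * w ^+ 2 - 4 * y ^+ 2].

(** The left side of the second equation is positive; for u <= 1/3 its right side is
    not. *)
Lemma system_gt3 (u w y : R) : 0 < u -> 0 < w -> 0 < y -> einstein_system u w y -> 1 / 3 < u.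
Proof.
have n3 := n_ge3; move=> u0 w0 y0 [_ yE _]; rewrite ltNge; apply/negP => u3.
have lhs : 0 < 4 * (n + 2) * y ^+ 2.
  by apply: mulr_gt0; [lra | exact: exprn_gt0].
have : (3 * u - 1) * (2 * (n + 2) * w ^+ 2 + 3 * (n - 2) * (1 - u)) <= 0.
  rewrite mulr_le0_ge0 //; first lra.
  have w2 : 0 <= w ^+ 2 by rewrite exprn_ge0 // ltW.
  by apply: addr_ge0; apply: mulr_ge0 => //; lra.
by rewrite -yE leNgt lhs.
Qed.

(** Eliminating y ^+ 2 between the last two equations of the system makes w - y
    proportional to 1 - u, with this factor. *)
Definition shape (u w : R) : R := (n + 2) * w ^+ 2 - (n - 2) * (3 * u - 1).

(** What remains of the second equation after substitution of y and division by
    1 - u, the step which discards the metrics with u = 1. *)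
Definition reduced (u w : R) : R :=
  12 * (n + 2) * u ^+ 2 * (shape u w + (n + 2) * w ^+ 2)
  - 8 * (n + 2) * u * w * shape u w + (1 - u) * shape u w ^+ 2.

Lemma system_reduced (u w y : R) : 0 < u -> u != 1 -> 6 * u * at_ w m_poly = at_ w nu_poly ->
  einstein_system u w y <->
  4 * (n + 2) * u * (w - y) = (1 - u) * shape u w /\ reduced u w = 0.
Proof.
have n3 := n_ge3; move=> u0 u1 Cuw; have K0 : n + 2 != 0 by apply: lt0r_neq0; lra.
have u_n0 := lt0r_neq0 u0; have u1' : 1 - u != 0 by rewrite subr_eq0 eq_sym.
have quad : (4 * (n + 2) * u * w - (1 - u) * shape u w) ^+ 2
    - 4 * (n + 2) * u ^+ 2 * ((3 * u - 1) * (2 * (n + 2) * w ^+ 2 + 3 * (n - 2) * (1 - u)))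
    = (1 - u) * reduced u w.
  by rewrite /reduced /shape; ring.
have scaled : 4 * (n + 2) * u * (w - y) = (1 - u) * shape u w ->
    4 * (n + 2) * u ^+ 2 * (4 * (n + 2) * y ^+ 2) =
      (4 * (n + 2) * u * w - (1 - u) * shape u w) ^+ 2.
  by move=> <-; ring.
have lin_comb : 3 * (4 * (n + 2) * u * (w - y) - (1 - u) * shape u w)
   = (n + 2) * (12 * u * (w - y) - ((3 * u + 1) * w ^+ 2 - 4 * y ^+ 2))
     - (4 * (n + 2) * y ^+ 2 - (3 * u - 1) * (2 * (n + 2) * w ^+ 2 + 3 * (n - 2) * (1 - u))).
  by rewrite /shape; ring.
split=> [[_ yE wE]|[yw red0]].
  have yw : 4 * (n + 2) * u * (w - y) = (1 - u) * shape u w.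
    move: lin_comb; rewrite yE wE !subrr mulr0 subr0 => /eqP.
    by rewrite mulf_eq0 pnatr_eq0 /= subr_eq0 => /eqP.
  split=> //; apply: (mulfI u1'); rewrite -quad -(scaled yw) yE mulr0.
  by rewrite subrr.
have yE : 4 * (n + 2) * y ^+ 2 = (3 * u - 1) * (2 * (n + 2) * w ^+ 2 + 3 * (n - 2) * (1 - u)).
  apply: (mulfI (_ : 4 * (n + 2) * u ^+ 2 != 0)).
    by rewrite !mulf_neq0 ?expf_neq0 ?pnatr_eq0.
  by apply/eqP; rewrite (scaled yw) -subr_eq0 quad red0 mulr0.
split=> //; move: lin_comb; rewrite yw yE !subrr mulr0 subr0 => /esym/eqP.
by rewrite mulf_eq0 (negPf K0) /= subr_eq0 => /eqP.
Qed.

Lemma p_poly_shape (u w : R) : 6 * u * at_ w m_poly = at_ w nu_poly -> at_ w p_poly = 2 * at_ w m_poly * shape u w.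
Proof.
move=> Cuw; have -> : at_ w p_poly = 2 * (n + 2) * at_ w m_poly * w ^+ 2 - (n - 2) * (at_ w nu_poly - 2 * at_ w m_poly).
  by rewrite /=; ring.
by rewrite -Cuw /shape; ring.
Qed.

Lemma g_poly_reduced (u w : R) : 6 * u * at_ w m_poly = at_ w nu_poly ->
  at_ w g_poly = 24 * at_ w m_poly ^+ 3 * reduced u w.
Proof.
move=> Cuw; have -> : at_ w g_poly = 4 * (n + 2) * at_ w nu_poly ^+ 2 * (at_ w p_poly + 2 * (n + 2) * at_ w m_poly * w ^+ 2)
    - 16 * (n + 2) * at_ w m_poly * at_ w nu_poly * w * at_ w p_poly + (6 * at_ w m_poly - at_ w nu_poly) * at_ w p_poly ^+ 2.
  rewrite /g_poly /q_poly /var_n /var_w /var_d; cbn [pev nth]; move: (pev _ m_poly) (pev _ nu_poly) (pev _ p_poly) => a b c; ring.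
rewrite (p_poly_shape Cuw) -Cuw /reduced; ring.
Qed.

Lemma zeta_poly_y (u w y : R) : u != 0 -> 6 * u * at_ w m_poly = at_ w nu_poly ->
  4 * (n + 2) * u * (w - y) = (1 - u) * shape u w ->
  at_ w zeta_poly = 8 * (n + 2) * at_ w m_poly * at_ w nu_poly * y.
Proof.
move=> u0 Cuw yw.
have -> : at_ w zeta_poly = 8 * (n + 2) * at_ w m_poly * at_ w nu_poly * w - (6 * at_ w m_poly - at_ w nu_poly) * at_ w p_poly.
  rewrite /zeta_poly /q_poly /var_n /var_w /var_d; cbn [pev nth]; move: (pev _ m_poly) (pev _ nu_poly) (pev _ p_poly) => a b c; ring.
rewrite (p_poly_shape Cuw) -Cuw.
have -> : 8 * (n + 2) * at_ w m_poly * (6 * u * at_ w m_poly) * y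
   = 12 * at_ w m_poly ^+ 2 * (4 * (n + 2) * u * w - 4 * (n + 2) * u * (w - y)) by ring.
by rewrite yw; ring.
Qed.

(** From 3u > 1 and 6 u m_poly = nu_poly, the sign of m_poly decides that of
    nu_poly - 2 m_poly = -(w - 1)((3n + 2) w - (n - 2)), hence the position of w. *)
Lemma system_region (u w : R) : 0 < w -> 1 / 3 < u -> 6 * u * at_ w m_poly = at_ w nu_poly ->
  [/\ 0 < at_ w m_poly, n - 2 < w * (3 * n + 2) & w * (n + 1) < n - 2]
  \/ at_ w m_poly < 0 /\ 1 < w < 3.
Proof.
have n3 := n_ge3; move=> w0 u3 Cuw.
have nuE_m : (w - 1) * ((3 * n + 2) * w - (n - 2)) = 2 * at_ w m_poly - at_ w nu_poly.
  by rewrite /=; ring.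
have mE_w : at_ w m_poly = ((n + 1) * w - (n - 2)) * (w - 1) - w by rewrite /=; ring.
have small_m : (3 * n + 2) * w <= n - 2 -> 0 < at_ w m_poly.
  by move=> w_small; rewrite mE_w; nra.
have one_m : w = 1 -> at_ w m_poly = -1 by move=> w1; rewrite mE_w w1; ring.
case: (ltgtP (at_ w m_poly) 0) => m0.
- right; split=> //.
  have prod : 0 < (w - 1) * ((3 * n + 2) * w - (n - 2)) by rewrite nuE_m -Cuw; nra.
  have w_big : n - 2 < (3 * n + 2) * w.
    by rewrite ltNge; apply/negP => /small_m; rewrite ltNge ltW.
  have w1 : 1 < w by nra.
  by rewrite w1 /= ltNge; apply/negP => w3; move: m0; rewrite mE_w; nra.
- left; have prod : (w - 1) * ((3 * n + 2) * w - (n - 2)) < 0 by rewrite nuE_m -Cuw; nra.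
  have w1 : w < 1 by rewrite ltNge; apply/negP => w1; nra.
  split=> //; first by nra.
  by rewrite ltNge; apply/negP => w_big; move: m0; rewrite mE_w; nra.
exfalso; have /eqP : (w - 1) * ((3 * n + 2) * w - (n - 2)) = 0.
  by rewrite nuE_m -Cuw m0 !mulr0 subrr.
rewrite mulf_eq0 !subr_eq0 => /orP[/eqP /one_m|/eqP w_eq].
  by rewrite m0 => /eqP; rewrite eq_sym oppr_eq0 oner_eq0.
have := small_m; rewrite w_eq lexx => /(_ isT).
by rewrite m0 ltxx.
Qed.

(** The system determines u and y from w: root_u solves its first equation, root_y the
    equation linear in y. *)
Definition root_u (w : R) : R := at_ w nu_poly / (6 * at_ w m_poly).

Definition root_y (w : R) : R :=
  w - (1 - root_u w) * shape (root_u w) w / (4 * (n + 2) * root_u w).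

Definition root_metric (w : R) : R * R * R := (root_u w / w, root_u w / root_y w, root_u w).

Lemma system_root_metric x z u : 0 < x -> 0 < z -> 0 < u -> u != 1 ->
    einstein_system u (u / x) (u / z) ->
  (x, z, u) = root_metric (u / x) /\ (left_root n (u / x) \/ right_root n (u / x)).
Proof.
have n3 := n_ge3; move=> x0 z0 u0 u1 sys.
have [Cuw _ _] := sys.
have w0 : 0 < u / x by rewrite divr_gt0.
have y0 : 0 < u / z by rewrite divr_gt0.
have u3 := system_gt3 u0 w0 y0 sys.
have [yw red0] := (system_reduced (u / z) u0 u1 Cuw).1 sys.
have g0 : at_ (u / x) g_poly = 0 by rewrite (g_poly_reduced Cuw) red0 mulr0.
have region := system_region w0 u3 Cuw.
have m_n0 : at_ (u / x) m_poly != 0.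
  by case: region => [[/lt0r_neq0]|[/ltr0_neq0]].
have K0 : 4 * (n + 2) * u != 0 by apply: lt0r_neq0; rewrite mulr_gt0 //; lra.
have uE : root_u (u / x) = u.
  by rewrite /root_u -Cuw; field; rewrite m_n0.
have yE : root_y (u / x) = u / z.
  by rewrite /root_y uE -yw mulrAC divff // mul1r opprB addrC subrK.
split; first by rewrite /root_metric uE yE !invf_div !mulrA ![u * _]mulrC !mulfK ?lt0r_neq0.
case: region => [[m0 w_lo w_hi]|[m0 /andP[w_lo w_hi]]]; [left|right]; split=> //; rewrite !linE; lra.
Qed.

Lemma root_metric_system w (u := root_u w) (y := root_y w) : 0 < w -> at_ w g_poly = 0 ->
    0 < at_ w m_poly * at_ w nu_poly -> 0 < at_ w zeta_poly -> u != 1 ->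
  [/\ 0 < u / w, 0 < u / y, 0 < u & einstein_system u (u / (u / w)) (u / (u / y))].
Proof.
have n3 := n_ge3; move=> w0 g0 mnu zeta0 u1.
have m_n0 : at_ w m_poly != 0 by apply: contraTneq mnu => ->; rewrite mul0r ltxx.
have Cuw : 6 * u * at_ w m_poly = at_ w nu_poly by rewrite /u /root_u; field.
have u0 : 0 < u.
  rewrite -(pmulr_rgt0 _ (_ : 0 < 6 * at_ w m_poly ^+ 2)); last by rewrite mulr_gt0 ?exprn_even_gt0.
  by rewrite (_ : _ * u = at_ w m_poly * at_ w nu_poly) // -Cuw; ring.
have K0 : 4 * (n + 2) * u != 0 by apply: lt0r_neq0; rewrite mulr_gt0 //; lra.
have yw : 4 * (n + 2) * u * (w - y) = (1 - u) * shape u w.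
  by rewrite /y /root_y -/u opprB [w + _]addrC subrK mulrC divfK.
have y0 : 0 < y.
  move: zeta0; rewrite (zeta_poly_y (lt0r_neq0 u0) Cuw yw) -[_ * at_ w m_poly * _]mulrA.
  by rewrite pmulr_rgt0 // mulr_gt0 //; lra.
have red0 : reduced u w = 0.
  apply/eqP; move/eqP: g0; rewrite (g_poly_reduced Cuw) mulf_eq0 mulf_eq0 pnatr_eq0.
  by rewrite expf_eq0 (negPf m_n0).
split; [exact: divr_gt0 | exact: divr_gt0 | exact: u0 |].
have divK a b : b != 0 -> a != 0 -> b / (b / a) = a :> R.
  by move=> b_n0 a_n0; rewrite invf_div mulrCA divff ?mulr1.
rewrite !divK ?lt0r_neq0 //.
by apply/(system_reduced y u0 u1 Cuw).
Qed.

End EinsteinSystem.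

(** Each equation of the system is a nonzero multiple of the difference of two Ricci
    eigenvalues. *)
Lemma ric_eigenvalue_system (R : realType) (n : nat) (x z u : R) :
    (0 < n)%N -> 0 < x -> 0 < z -> 0 < u ->
  (exists lam, forall b, ric_eigenvalue n x z u b = lam) <->
  einstein_system n%:R u (u / x) (u / z).
Proof.
move=> n0 x0 z0 u0.
have [x_n0 z_n0 u_n0] : [/\ x != 0, z != 0 & u != 0] by rewrite !gt_eqF.
have n_n0 : n%:R != 0 :> R by rewrite pnatr_eq0 -lt0n.
pose r (i : nat) (i5 : (i < 5)%N) := ric_eigenvalue n x z u (Ordinal i5).
set N := n%:R in n_n0 *.
have r03 : 6 * u * pev [:: N; u / x; 1] m_poly - pev [:: N; u / x; 1] nu_poly
    = - (24 * N * u ^+ 2) * (@r 0 isT - @r 3 isT).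
  by rewrite /r /ric_eigenvalue /=; field; rewrite ?x_n0 ?z_n0 ?u_n0 ?n_n0.
have r34 : 4 * (N + 2) * (u / z) ^+ 2
    - (3 * u - 1) * (2 * (N + 2) * (u / x) ^+ 2 + 3 * (N - 2) * (1 - u))
    = - (48 * N * u ^+ 2) * (@r 3 isT - @r 4 isT).
  by rewrite /r /ric_eigenvalue /=; field; rewrite ?x_n0 ?z_n0 ?u_n0 ?n_n0.
have r02 : 12 * u * (u / x - u / z) - ((3 * u + 1) * (u / x) ^+ 2 - 4 * (u / z) ^+ 2)
    = 24 * u ^+ 2 * (@r 0 isT - @r 2 isT).
  by rewrite /r /ric_eigenvalue /=; field; rewrite ?x_n0 ?z_n0 ?u_n0 ?n_n0.
have eq_r (c l l' a b : R) : c != 0 -> l - l' = c * (a - b) -> l = l' <-> a = b.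
  move=> c0 E; split=> [ll'|ab]; apply/eqP; rewrite -subr_eq0.
    by move/eqP: E; rewrite ll' subrr eq_sym mulf_eq0 (negPf c0).
  by rewrite E ab subrr mulr0.
have u2 : u ^+ 2 != 0 by rewrite expf_neq0.
have k03 : - (24 * N * u ^+ 2) != 0 by rewrite oppr_eq0; do 2!apply: mulf_neq0 => //; rewrite pnatr_eq0.
have k34 : - (48 * N * u ^+ 2) != 0 by rewrite oppr_eq0; do 2!apply: mulf_neq0 => //; rewrite pnatr_eq0.
have k02 : 24 * u ^+ 2 != 0 by apply: mulf_neq0 => //; rewrite pnatr_eq0.
have {}r03 := eq_r _ _ _ _ _ k03 r03.
have {}r34 := eq_r _ _ _ _ _ k34 r34.
have {}r02 := eq_r _ _ _ _ _ k02 r02.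
split=> [[lam ric_lam]|[/r03 e03 /r34 e34 /r02 e02]].
  have rE i i5 : @r i i5 = lam by exact: ric_lam.
  by split; [apply/r03|apply/r34|apply/r02]; rewrite !rE.
exists (@r 0 isT) => b.
case: b => [[|[|[|[|[|//]]]]] i5].
- by [].
- by [].
- by rewrite e02; congr (ric_eigenvalue _ _ _ _ _); apply: val_inj.
- by rewrite e03; congr (ric_eigenvalue _ _ _ _ _); apply: val_inj.
by rewrite e03 e34; congr (ric_eigenvalue _ _ _ _ _); apply: val_inj.
Qed.

Theorem theorem4p4 (R : realType) (n : nat) (hn : n = 3%N \/ (5 <= n)%N) :
  let E (m : R * R * R) :=
    let: (x, z, u) := m in
    [/\ 0 < x, 0 < z, 0 < u, u <> 1 & is_einstein_metric n x z u] in
  [/\ exists! m : R * R * R, E m /\ (1 / 6 < m.2 < 1),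
      exists! m : R * R * R, E m /\ 1 < m.2
    & exists m1 m2 : R * R * R, m1 <> m2 /\
        forall m : R * R * R, E m <-> (m = m1 \/ m = m2)].
Proof.
move=> E; have n1 : (1 < n)%N by lia.
have n3 : 3 <= n%:R :> R by rewrite ler_nat; lia.
have [w1 left1 [w1_gt0 m1 nu1 q1 zeta1]] := left_root_exists n3.
have [w2 right2 [w2_gt0 m2 nu2 q2 zeta2]] := right_root_exists n3.
pose M1 := root_metric n%:R w1; pose M2 := root_metric n%:R w2.
have qE_m w : pev [:: n%:R; w; 1] q_poly = 6 * pev [:: n%:R; w; 1] m_poly - pev [:: n%:R; w; 1] nu_poly :> R.
  by [].
have u1_lt1 : M1.2 < 1.
  by rewrite [M1.2]/(root_u _ _) /root_u ltr_pdivrMr ?mulr_gt0 // mul1r -subr_gt0 -qE_m.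
have u2_gt1 : 1 < M2.2.
  by rewrite [M2.2]/(root_u _ _) /root_u ltr_ndivlMr ?pmulr_rlt0 // mul1r -subr_gt0 -qE_m.
have E_system m : E m <-> [/\ 0 < m.1.1, 0 < m.1.2, 0 < m.2, m.2 != 1
    & einstein_system n%:R m.2 (m.2 / m.1.1) (m.2 / m.1.2)].
  case: m => [[x z] u] /=; split.
    move=> [x0 z0 u0 /eqP u1 /(einstein_metricE n1 x0 z0 u0)].
    by move/(ric_eigenvalue_system (ltnW n1) x0 z0 u0).
  move=> [x0 z0 u0 /eqP u1 /(ric_eigenvalue_system (ltnW n1) x0 z0 u0)].
  by move/(einstein_metricE n1 x0 z0 u0).
have [_ _ g1] := left1; have [_ _ g2] := right2.
have E1 : E M1.
  apply/E_system; have u1 : M1.2 != 1 by rewrite lt_eqF.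
  by have [] := root_metric_system n3 w1_gt0 g1 (mulr_gt0 m1 nu1) zeta1 u1.
have E2 : E M2.
  apply/E_system; have u1 : M2.2 != 1 by rewrite gt_eqF.
  have mnu : 0 < pev [:: n%:R; w2; 1] m_poly * pev [:: n%:R; w2; 1] nu_poly by rewrite nmulr_rgt0.
  by have [] := root_metric_system n3 w2_gt0 g2 mnu zeta2 u1.
have E_only m : E m -> m = M1 \/ m = M2.
  case: m => [[x z] u] /E_system /= [x0 z0 u0 u1 sys].
  have [-> [left_w|right_w]] := system_root_metric n3 x0 z0 u0 u1 sys.
    by left; rewrite (left_root_unique n3 left_w left1).
  by right; rewrite (right_root_unique n3 right_w right2).
have u1_gt : 1 / 6 < M1.2.
  have /E_system[x0 z0 u0 _ sys] := E1.
  have := system_gt3 n3 u0 (divr_gt0 u0 x0) (divr_gt0 u0 z0) sys; lra.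
split.
- exists M1; split=> [|m [/E_only[->|->] // /andP[_]]]; first by rewrite u1_gt.
  by rewrite ltNge ltW.
- exists M2; split=> [//|m [/E_only[->|->] //]].
  by rewrite ltNge ltW.
exists M1, M2; split=> [M12|m]; first by move: u2_gt1; rewrite -M12 ltNge ltW.
by split=> [/E_only|[->|->]].
Qed.
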